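(* Let $X,Y$ be Hilbert spaces, let $S_1,S_2:X\rightrightarrows Y$ be set-valued mappings, let $\Omega\subset X$ be closed and convex, and let $(\bar x,\bar y)\in\operatorname{gph}(S_1+S_2)|_\Omega$. Define $G:X\times Y\rightrightarrows Y\times Y$ by $$G(x,y):=\{(y_1,y_2)\in Y\times Y\mid y_1\in S_1(x),\ y_2\in S_2(x),\ y_1+y_2=y\}.$$ Fix $(\bar y_1,\bar y_2)\in G(\bar x,\bar y)$ and let $G$ be inner semicontinuous relative to $\Omega\times Y$ at $(\bar x,\bar y,\bar y_1,\bar y_2)$. Assume that the graphs of $S_1$ and $S_2$ are locally closed around $(\bar x,\bar y_1)$ and $(\bar x,\bar y_2)$, respectively, that either $S_1$ is PSNC relative to $\Omega$ at $(\bar x,\bar y_1)$ or $S_2$ is PSNC relative to $\Omega$ at $(\bar x,\bar y_2)$, and that $$D^{c*}_\Omega S_1(\bar x|\bar y_1)(0)\cap\big(-D^{c*}_\Omega S_2(\bar x|\bar y_2)(0)\big)=\{0\}.$$ Then for all $y^*\in Y$, $$D^{c*}_\Omega(S_1+S_2)(\bar x|\bar y)(y^* )\subset D^{c*}_\Omega S_1(\bar x|\bar y_1)(y^* )+D^{c*}_\Omega S_2(\bar x|\bar y_2)(y^* ),$$ $$\widetilde D^{c*}_\Omega(S_1+S_2)(\bar x|\bar y)(y^* )\subset\widetilde D^{c*}_\Omega S_1(\bar x|\bar y_1)(y^* )+\widetilde D^{c*}_\Omega S_2(\bar x|\bar y_2)(y^* ).$$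
   Context: Hilbert spaces are identified with their duals (the duality mapping is the identity); products carry the Euclidean norm $\|(x,y)\|=\sqrt{\|x\|^2+\|y\|^2}$. $\rightharpoonup^*$ denotes weak$^*$ (here: weak) sequential convergence; $\varepsilon_k\downarrow0$ means $\varepsilon_k\ge0$, $\varepsilon_k\to0$. $(S_1+S_2)(x)=\{y_1+y_2\mid y_i\in S_i(x)\}$. For $S:X\rightrightarrows Y$, $\operatorname{gph}S|_\Omega=\{(x,y)\mid x\in\Omega,\ y\in S(x)\}$ and $\operatorname{dom}S=\{x\mid S(x)\ne\emptyset\}$. Tangent (contingent) cone: $w\in T(\bar x;\Omega)$ iff there are $t_k>0$, $t_k\to0$, $w_k\to w$ with $\bar x+t_kw_k\in\Omega$ for all $k$. For $\varepsilon\ge0$, $\Lambda\subset Z$, $\bar z\in\Lambda$: $\widehat N^c_\varepsilon(\bar z;\Lambda)=\{z^*\in Z^*\mid\limsup_{z\to\bar z,\,z\in\Lambda}\frac{\langle z^*,z-\bar z\rangle}{\|z-\bar z\|}\le\varepsilon\|z^*\|\}$ (limsup over $z\ne\bar z$; vacuous if $\bar z$ is isolated in $\Lambda$). Conic normal contingent coderivative relative to $\Omega$ at $(\bar x,\bar y)\in\operatorname{gph}S|_\Omega$: $x^*\in\widetilde D^{c*}_\Omega S(\bar x|\bar y)(y^* )$ iff there exist $\varepsilon_k\downarrow0$, $(x_k,y_k)\in\operatorname{gph}S|_\Omega$ with $(x_k,y_k)\to(\bar x,\bar y)$, and $(x_k^*,-y_k^* )\in\widehat N^c_{\varepsilon_k}((x_k,y_k);\operatorname{gph}S|_\Omega)\cap[T(x_k;\Omega)\times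 Y]$ with $x_k^*\rightharpoonup^*x^*$ and $y_k^*\rightharpoonup^*y^*$. The conic mixed contingent coderivative $D^{c*}_\Omega S(\bar x|\bar y)$ is defined identically except that $y_k^*\to y^*$ strongly. $S$ is PSNC relative to $\Omega$ at $(\bar x,\bar y)\in\operatorname{gph}S|_\Omega$ if for all $\varepsilon_k\downarrow0$, $(x_k,y_k)\to(\bar x,\bar y)$ in $\operatorname{gph}S|_\Omega$, $(x_k^*,-y_k^* )\in\widehat N^c_{\varepsilon_k}((x_k,y_k);\operatorname{gph}S|_\Omega)\cap[T(x_k;\Omega)\times Y]$ with $x_k^*\rightharpoonup^*0$ and $y_k^*\to0$, one has $\|x_k^*\|\to0$. $G$ is inner semicontinuous relative to $\Omega\times Y$ at $(\bar x,\bar y,\bar y_1,\bar y_2)$ if for every sequence $(x_k,y_k)\to(\bar x,\bar y)$ in $\operatorname{dom}G\cap(\Omega\times Y)$ there are $(y_{1k},y_{2k})\in G(x_k,y_k)$ with $(y_{1k},y_{2k})\to(\bar y_1,\bar y_2)$. *)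

(* Defs.v *)
From HB Require Import structures.
From mathcomp Require Import all_boot all_order all_algebra.
From mathcomp Require Import all_classical all_reals all_analysis.
Set Implicit Arguments.
Unset Strict Implicit.
Unset Printing Implicit Defensive.
Import Order.TTheory GRing.Theory Num.Theory.
Import numFieldNormedType.Exports.
Local Open Scope classical_set_scope.
Local Open Scope ring_scope.

HB.mixin Record CompleteNormedModule_isHilbert (R : realType) V
    of CompleteNormedModule R V := {
  inner : {dot V for idfun} ;
  norm_inner : forall x : V, `|x| = Num.sqrt (inner x x)
}.

#[short(type="hilbertType")]
HB.structure Definition Hilbert (R : realType) :=
  {V of CompleteNormedModule R V & CompleteNormedModule_isHilbert R V}.

Arguments inner {R s}.

Section Hilbert_defs.
Context {R : realType}.

(* The library norm on [X * Y] is the max norm.  It induces the product topology,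
   but the Euclidean norm is the one needed in the epsilon-normals below. *)
Definition prod_inner (X Y : hilbertType R) (p q : X * Y) : R :=
  inner p.1 q.1 + inner p.2 q.2.

Definition prod_norm (X Y : hilbertType R) (p : X * Y) : R :=
  Num.sqrt (prod_inner p p).

(* Dual spaces being identified with the spaces themselves, this is weak and
   weak* convergence alike. *)
Definition weak_cvg (X : hilbertType R) (u : nat -> X) (l : X) : Prop :=
  forall v : X, (fun k => inner (u k) v) @ \oo --> (inner l v : R).

Definition tangent_cone (X : hilbertType R) (Om : set X) (x : X) : set X :=
  [set w | exists (t : nat -> R) (ws : nat -> X),
    [/\ forall k, 0 < t k, t @ \oo --> (0 : R), ws @ \oo --> w
      & forall k, Om (x + t k *: ws k)]].

(* When [z] is isolated in [A], the filter contains [set0] and the limsup is -oo. *)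
Definition eps_normal (X Y : hilbertType R) (eps : R) (A : set (X * Y))
    (z : X * Y) : set (X * Y) :=
  [set zs : X * Y |
    (limf_esup (fun z' : X * Y => (prod_inner zs (z' - z) / prod_norm (z' - z))%:E)
       (within A z^') <= (eps * prod_norm zs)%:E)%E].

Definition sum_set (V : zmodType) (A B : set V) : set V :=
  [set a + b | a in A & b in B].

Definition gph_on (X Y : Type) (S : X -> set Y) (Om : set X) : set (X * Y) :=
  [set p | Om p.1 /\ S p.1 p.2].

Definition dom (X Y : Type) (S : X -> set Y) : set X := [set x | S x !=set0].

Definition sum_map (X : Type) (V : zmodType) (S1 S2 : X -> set V) : X -> set V :=
  fun x => sum_set (S1 x) (S2 x).

(* The conditions common to the coderivatives and to PSNC: the convergence of
   the dual sequences [xs] and [ys] is left to the definitions below. *)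
Definition normal_seq (X Y : hilbertType R) (Om : set X) (S : X -> set Y)
    (xb : X) (yb : Y) (eps : nat -> R) (z : nat -> X * Y)
    (xs : nat -> X) (ys : nat -> Y) : Prop :=
  [/\ forall k, 0 <= eps k, eps @ \oo --> (0 : R),
      forall k, gph_on S Om (z k), z @ \oo --> (xb, yb)
    & forall k, (eps_normal (eps k) (gph_on S Om) (z k) `&`
                 (tangent_cone Om (z k).1 `*` [set: Y])) (xs k, - ys k)].

Definition normal_coderivative (X Y : hilbertType R) (Om : set X)
    (S : X -> set Y) (xb : X) (yb : Y) (y : Y) : set X :=
  [set x | exists eps z xs ys, [/\ normal_seq Om S xb yb eps z xs ys,
                                   weak_cvg xs x & weak_cvg ys y]].

Definition mixed_coderivative (X Y : hilbertType R) (Om : set X)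
    (S : X -> set Y) (xb : X) (yb : Y) (y : Y) : set X :=
  [set x | exists eps z xs ys, [/\ normal_seq Om S xb yb eps z xs ys,
                                   weak_cvg xs x & ys @ \oo --> y]].

Definition PSNC (X Y : hilbertType R) (Om : set X) (S : X -> set Y)
    (xb : X) (yb : Y) : Prop :=
  forall eps z xs ys, normal_seq Om S xb yb eps z xs ys ->
    weak_cvg xs 0 -> ys @ \oo --> (0 : Y) ->
    (fun k => `|xs k|) @ \oo --> (0 : R).

End Hilbert_defs.

Definition inner_semicontinuous (U V : topologicalType) (G : U -> set V)
    (D : set U) (u : U) (v : V) : Prop :=
  forall us : nat -> U, (forall k, (dom G `&` D) (us k)) -> us @ \oo --> u ->
    exists vs : nat -> V, (forall k, G (us k) (vs k)) /\ vs @ \oo --> v.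

Definition locally_closed_at (U : topologicalType) (A : set U) (u : U) : Prop :=
  exists V : set U, [/\ nbhs u V, closed V & closed (A `&` V)].

Definition sum_decomp (X : Type) (V : zmodType) (S1 S2 : X -> set V) :
    X * V -> set (V * V) :=
  fun p => [set q | [/\ S1 p.1 q.1, S2 p.1 q.2 & q.1 + q.2 = p.2]].

(* Main.v *)
Require Import Defs.
From HB Require Import structures.
From mathcomp Require Import all_boot all_order all_algebra.
From mathcomp Require Import all_classical all_reals all_analysis.
From mathcomp Require Import ring lra.

(* A normal (xs, - ys) to the graph of S1 + S2 at (x, y1 + y2) says that
   - <xs, .> + <ys, y1 + y2> plus a small norm term is locally nonnegative on the
   pairs of points of gph S1 and gph S2 with equal first components.  Applying
   Ekeland's principle to the Euclidean norm of (x1 - x2, [that function + t]_+)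
   on gph S1 x gph S2 decouples the two graphs: with (p, lam) the gradient of the
   norm, a unit vector, (lam xs - p, - lam ys) and (p, - lam ys) are approximate
   normals to gph S1 and gph S2.  By convexity of Om, p and - p, multiples of
   differences of points of Om, lie in the tangent cones, and xs does up to a small
   error as soon as t is small compared with the step realizing xs as a tangent.
   Along a sequence, lam -> 0 would make the weak limit of p violate the
   qualification condition unless it is 0, and PSNC would then force |p| -> 0, which
   contradicts |p|^2 + lam^2 = 1.  So one can divide by lam and take a weak limit of
   p / lam. *)

Set Implicit Arguments.
Unset Strict Implicit.
Unset Printing Implicit Defensive.
Import Order.TTheory GRing.Theory Num.Theory.
Import numFieldNormedType.Exports.
Local Open Scope classical_set_scope.
Local Open Scope ring_scope.

(** * Hilbert spaces and weak convergence *)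

Section inner_product.
Context {R : realType} {X : hilbertType R}.
Implicit Types (x y z : X) (a : R).

Lemma innerC x y : inner x y = inner y x.
Proof. by rewrite (hermitian_subproof (s := inner)) expr0 mul1r. Qed.

Lemma innerDr x y z : inner x (y + z) = inner x y + inner x z.
Proof. exact: linearD. Qed.

Lemma innerZr a x y : inner x (a *: y) = a * inner x y.
Proof. exact: linearZ. Qed.

Lemma innerDl x y z : inner (x + y) z = inner x z + inner y z.
Proof. by rewrite innerC innerDr !(innerC z). Qed.

Lemma innerZl a x y : inner (a *: x) y = a * inner x y.
Proof. by rewrite innerC innerZr innerC. Qed.

Lemma innerNr x y : inner x (- y) = - inner x y.
Proof. by rewrite -scaleN1r innerZr mulN1r. Qed.

Lemma innerNl x y : inner (- x) y = - inner x y.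
Proof. by rewrite innerC innerNr innerC. Qed.

Lemma innerBr x y z : inner x (y - z) = inner x y - inner x z.
Proof. by rewrite innerDr innerNr. Qed.

Lemma innerBl x y z : inner (x - y) z = inner x z - inner y z.
Proof. by rewrite innerDl innerNl. Qed.

Lemma inner0r x : inner x 0 = 0.
Proof. by rewrite -(scale0r 0) innerZr mul0r. Qed.

Lemma inner0l x : inner 0 x = 0.
Proof. by rewrite innerC inner0r. Qed.

Lemma inner_ge0 x : 0 <= inner x x.
Proof.
have [->|/(neq0_dnorm_gt0 (s := inner))/ltW//] := eqVneq x 0.
by rewrite inner0r.
Qed.

Lemma innerxx x : inner x x = `|x| ^+ 2.
Proof. by rewrite norm_inner sqr_sqrtr// inner_ge0. Qed.

Lemma sqr_normD x y : `|x + y| ^+ 2 = `|x| ^+ 2 + 2 * inner x y + `|y| ^+ 2.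
Proof. rewrite -!innerxx innerDl !innerDr (innerC y x); ring. Qed.

Lemma sqr_normB x y : `|x - y| ^+ 2 = `|x| ^+ 2 - 2 * inner x y + `|y| ^+ 2.
Proof. by rewrite sqr_normD innerNr normrN; ring. Qed.

Lemma CauchySchwarz_inner x y : `|inner x y| <= `|x| * `|y|.
Proof.
have [->|y0] := eqVneq y 0; first by rewrite inner0r normr0 mulr_ge0.
have y2 : 0 < `|y| ^+ 2 by rewrite exprn_gt0// normr_gt0.
rewrite -ler_sqr ?nnegrE ?mulr_ge0// real_normK ?num_real// exprMn.
(* This square expands to [|y| ^+ 2] times the gap between the squares of the two sides. *)
have := sqr_ge0 `|(`|y| ^+ 2) *: x - inner x y *: y|.
rewrite sqr_normB innerZr innerZl !normrZ !exprMn !real_normK ?num_real//.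
rewrite [leRHS](_ : _ = `|y| ^+ 2 * (`|x| ^+ 2 * `|y| ^+ 2 - inner x y ^+ 2));
  last by ring.
by rewrite pmulr_rge0// subr_ge0.
Qed.

Lemma inner_le x y : inner x y <= `|x| * `|y|.
Proof. exact: le_trans (ler_norm _) (CauchySchwarz_inner x y). Qed.

Lemma continuous_inner y : continuous (fun x => inner x y : R).
Proof.
move=> x; apply/(@cvgrPdist_le _ R^o) => e e0; near=> z.
rewrite -innerBl; apply: le_trans (CauchySchwarz_inner _ _) _.
apply: (@le_trans _ _ (`|x - z| * (`|y| + 1))).
  by rewrite ler_wpM2l// lerDl.
rewrite -ler_pdivlMr ?ltr_wpDl//; near: z.
by apply: cvgr_dist_le; [exact: cvg_id|rewrite divr_gt0// ltr_wpDl].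
Unshelve. all: by end_near. Qed.

Lemma cvg_innerl (T : Type) (F : set_system T) (u : T -> X) x y :
  Filter F -> u @ F --> x -> inner (u k) y @[k --> F] --> (inner x y : R).
Proof.
move=> FF ux; apply: (@cvg_comp _ _ _ u (fun z => inner z y : R) _ _ _ ux).
exact: continuous_inner.
Qed.

Lemma cvg_innerr (T : Type) (F : set_system T) (u : T -> X) x y :
  Filter F -> u @ F --> x -> inner y (u k) @[k --> F] --> (inner y x : R).
Proof.
by move=> FF ux; rewrite innerC; under eq_fun do rewrite innerC; exact: cvg_innerl.
Qed.

End inner_product.

Section sequences_extra.
Context {R : realType}.

Definition cauchy_sequence (V : normedModType R) (u : nat -> V) :=
  forall e : R, 0 < e -> exists N, forall m n,
    (N <= m)%N -> (N <= n)%N -> `|u m - u n| <= e.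

(** A property of normed modules rather than a structure on them, so that it passes from two factors
    to their product and can feed [Ekeland] on pairs of graph points. *)
Definition sequentially_complete (V : normedModType R) :=
  forall u : nat -> V, cauchy_sequence u -> cvgn u.

Lemma complete_sequentially_complete (V : completeNormedModType R) :
  sequentially_complete V.
Proof.
move=> u uC; apply: cauchy_cvg; apply/cauchy_ballP => e e0.
have [N NP] := uC (e / 2) (divr_gt0 e0 (ltr0n _ 2)).
near=> x.
suff : ball x.1 e x.2 by [].
near: x.
exists ([set u n | n in [set n | (N <= n)%N]],
        [set u n | n in [set n | (N <= n)%N]]).
  by split; exists N => // n /= Nn; exists n.
move=> [_ _] [[m Nm <-] [n Nn <-]]; rewrite /= -ball_normE/=.
by apply: le_lt_trans (NP _ _ Nm Nn) _; rewrite ltr_pdivrMr// ltr_pMr// ltr1n.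
Unshelve. all: by end_near. Qed.

Lemma invS_small (e : R) : 0 < e ->
  exists N, forall n, (N <= n)%N -> (n.+1%:R)^-1 < e :> R.
Proof.
move=> e0; have [N _ NP] : \forall n \near \oo, (n.+1%:R)^-1 < e :> R.
  exact: near_infty_natSinv_lt (PosNum e0).
by exists N.
Qed.

Lemma cvg_subseq (T : topologicalType) (u : nat -> T) (l : T) (phi : nat -> nat) :
  (forall k, (k <= phi k)%N) -> u @ \oo --> l -> (u \o phi) @ \oo --> l.
Proof.
move=> phik ul; apply: cvg_comp ul => A [N _ NA].
exists N => // n /= Nn; apply: NA => /=; exact: leq_trans Nn (phik n).
Qed.

End sequences_extra.

(** * Weak sequential compactness of bounded sequences *)

Section weak_compactness.
Context {R : realType} {X : hilbertType R}.
Implicit Types (u b : nat -> X) (v w : X).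

(** The representing vector is the minimizer of [J]. The linear part of [J] cancels in the
    parallelogram identity, so a minimizing sequence is Cauchy, and the first-order condition at its
    limit is the representation. *)
Lemma Riesz (L : X -> R) (M : R) :
  (forall v w, L (v + w) = L v + L w) -> (forall a v, L (a *: v) = a * L v) ->
  (forall v, `|L v| <= M * `|v|) -> exists w, forall v, L v = inner w v.
Proof.
move=> LD LZ LM.
pose J v : R := `|v| ^+ 2 - 2 * L v.
have J_lb : has_lbound (range J).
  exists (- M ^+ 2) => _ [v _ <-]; rewrite /J.
  have := LM v; rewrite ler_norml => /andP[_].
  have := sqr_ge0 (`|v| - M); nra.
have J_inf : has_inf (range J) by split => //; exists (J 0); exists 0.
have [v vP] : {v : nat -> X & forall n, J (v n) < inf (range J) + n.+1%:R^-1}.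
  apply: (@choice _ _ (fun n x => J x < inf (range J) + n.+1%:R^-1)) => n.
  have n0 : 0 < n.+1%:R^-1 :> R by rewrite invr_gt0.
  have [_ [x _ <-] xP] := inf_adherent n0 J_inf.
  by exists x.
have infJ x : inf (range J) <= J x by apply: ge_inf => //; exists x.
have parallelogram x y :
    `|x - y| ^+ 2 = 2 * (J x + J y - 2 * J (2^-1 *: (x + y))).
  rewrite /J LZ LD normrZ exprMn real_normK ?num_real// sqr_normB sqr_normD.
  by field.
have vC : cauchy_sequence v.
  move=> e e0; have e4 : 0 < e ^+ 2 / 4 by rewrite divr_gt0// exprn_gt0.
  have [N NP] := invS_small e4.
  exists N => m n Nm Nn.
  rewrite -ler_sqr ?nnegrE ?(ltW e0)// parallelogram.
  have := infJ (2^-1 *: (v m + v n)); have := vP m; have := vP n.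
  have := NP _ Nm; have := NP _ Nn.
  move: (n.+1%:R^-1) (m.+1%:R^-1) (inf _) (J _) (J _) (J _) => a b c ? ? ?.
  by lra.
have [w vw] : exists w, v @ \oo --> w.
  by have /cvg_ex[w ?] := complete_sequentially_complete vC; exists w.
exists w => h; apply/eqP; rewrite eq_sym -subr_eq0; apply/eqP.
set d := _ - _.
(* Compare [J] at [v n] and at [v n + t *: h], then let [n] grow: minimality makes this quadratic
   polynomial in [t] nonnegative. *)
have dP (t : R) : 0 <= 2 * t * d + t ^+ 2 * `|h| ^+ 2.
  have cv : (fun n => 2 * t * (inner (v n) h - L h) + t ^+ 2 * `|h| ^+ 2
              + n.+1%:R^-1) @ \oo --> 2 * t * d + t ^+ 2 * `|h| ^+ 2 + 0.
    apply: cvgD; last exact: cvg_harmonic.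
    apply: cvgD; last exact: cvg_cst.
    apply: cvgMr; apply: cvgB; last exact: cvg_cst.
    exact: cvg_innerl.
  rewrite -[leRHS]addr0; apply: (cvgr_to_ge cv); near=> n.
  have := infJ (v n + t *: h); have := vP n; rewrite /J LD LZ sqr_normD innerZr.
  by rewrite normrZ exprMn real_normK ?num_real//; move: (n.+1%:R^-1) => a; lra.
(* Nearly the minimizing [t]; the added 1 keeps the denominator positive when [h] is 0. The
   polynomial becomes a negative multiple of [d ^+ 2]. *)
have := dP (- d / (`|h| ^+ 2 + 1)); have := sqr_ge0 `|h|.
move: (_ ^+ 2) => H H0; have H1 : 0 < H + 1 by lra.
rewrite (_ : _ + _ = - (d ^+ 2 * ((H + 2) / (H + 1) ^+ 2))); last first.
  by field; rewrite gt_eqF.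
rewrite oppr_ge0 pmulr_lle0; last by rewrite divr_gt0 ?exprn_gt0//; lra.
by rewrite real_exprn_even_le0 ?num_real//= => /eqP.
Unshelve. all: by end_near. Qed.


(* If [|<b j, v>| >= e] for infinitely many [j], a signed sum [s] of [n] widely
   spaced ones satisfies [n e <= <s, v>] and [|s|^2 <= n (M^2 + 2)], which
   contradicts Cauchy-Schwarz for large [n]. *)
Lemma almost_orthogonal_weak_cvg0 b (M : R) : (forall j, `|b j| <= M) ->
  (forall i, (fun j => inner (b j) (b i)) @ \oo --> (0 : R)) -> weak_cvg b 0.
Proof.
move=> bM b_orth v; have M0 : 0 <= M by exact: le_trans (bM 0%N).
rewrite inner0l; apply/cvgr0Pnorm_lt => e e0.
apply: contrapT => far.
have farN N : exists2 j, (N <= j)%N & e <= `|inner (b j) v|.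
  apply: contrapT => H; apply: far; exists N => // j /= Nj.
  by rewrite ltNge; apply/negP => ?; apply: H; exists j.
have key n : exists s, [/\ (fun j => inner (b j) s) @ \oo --> (0 : R),
    `|s| ^+ 2 <= n%:R * (M ^+ 2 + 2) & n%:R * e <= inner s v].
  elim: n => [|n [s [s0 sM sv]]].
    exists 0; split; rewrite ?mul0r ?inner0l ?normr0 ?expr0n//.
    by under eq_fun do rewrite inner0r; exact: cvg_cst.
  (* Wide spacing: the next index is so far out that the cross term [2 * inner (b j) s] is below 2,
     hence the increment [M ^+ 2 + 2] of the squared norm. *)
  have [N _ NP] : \forall j \near \oo, `|inner (b j) s| < 1.
    by move/cvgr0Pnorm_lt : s0; exact.
  have [j Nj ej] := farN N; have := NP j Nj; rewrite /= ltr_norml => /andP[bs1 bs2].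
  have bj2 : `|b j| ^+ 2 <= M ^+ 2 by rewrite lerXn2r ?nnegrE ?M0 ?bM.
  rewrite -[n.+1]addn1 natrD !mulrDl !mul1r.
  have [jv|jv] := leP 0 (inner (b j) v).
  - exists (s + b j); split.
    + under eq_fun do rewrite innerDr.
      by rewrite -[0]addr0; apply: cvgD.
    + by rewrite sqr_normD innerC; lra.
    + by rewrite innerDl; rewrite ger0_norm// in ej; lra.
  - exists (s - b j); split.
    + under eq_fun do rewrite innerBr.
      by rewrite -[0]subr0; apply: cvgB.
    + by rewrite sqr_normB innerC; lra.
    + by rewrite innerBl; rewrite ltr0_norm// in ej; lra.
pose c := (M ^+ 2 + 2) * `|v| ^+ 2 / e ^+ 2.
have e2 : 0 < e ^+ 2 by rewrite exprn_gt0.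
have c0 : 0 <= c by rewrite !mulr_ge0 ?invr_ge0 ?sqr_ge0// addr_ge0 ?sqr_ge0.
have [s [_ sM sv]] := key (Num.bound c).
have := archi_boundP c0; move: (Num.bound c) sM sv => n sM sv.
rewrite ltr_pdivrMr// ltNge => /negP; apply.
have n0 : 0 <= n%:R * e by rewrite mulr_ge0// ltW.
have : (n%:R * e) ^+ 2 <= n%:R * (M ^+ 2 + 2) * `|v| ^+ 2.
  apply: (@le_trans _ _ ((`|s| * `|v|) ^+ 2)).
    rewrite lerXn2r ?nnegrE//.
    by apply: (le_trans sv); exact: inner_le.
  by rewrite exprMn ler_wpM2r ?sqr_ge0.
(* A factor [n] is about to be cancelled, so [n = 0] is treated apart. *)
case: n {sM sv n0} => [|n]; first by rewrite !mul0r !mulr_ge0// addr_ge0 ?sqr_ge0.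
by rewrite exprMn expr2 -!mulrA ler_pM2l.
Qed.

(* The limit [w] represents the limit of [<u k, .>] along an ultrafilter; the
   subsequence is chosen so that the [u (phi k) - w] are almost orthogonal. *)
Lemma weak_sequential_compactness u (M : R) : (forall k, `|u k| <= M) ->
  exists phi w, (forall k, (k <= phi k)%N) /\ weak_cvg (u \o phi) w.
Proof.
move=> uM.
have [U [UU UF]] := @ultraFilterLemma nat \oo _.
have UP : ProperFilter U by exact: ultra_proper.
(* The bounded values have a cluster point along [U]. An ultrafilter contains each set or its
   complement, so the cluster point is a limit. *)
have Lcvg v : exists l : R, inner (u k) v @[k --> U] --> l.
  have [|l [_ ul]] := @segment_compact R (- (M * `|v|)) (M * `|v|)
                      (inner (u k) v @[k --> U]) _.
    apply: (@filterE _ U) => k; rewrite /= in_itv/= -ler_norml.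
    by apply: le_trans (CauchySchwarz_inner _ _) _; rewrite ler_wpM2r.
  exists l; apply/cvgrPdist_lt => e e0.
  have [//|Ul] := in_ultra_setVsetC [set k | `|l - inner (u k) v| < e] UU.
  have [_ [[k /= + <-] /=]] : [set inner (u k) v | k in
      ~` [set k | `|l - inner (u k) v| < e]] `&` ball l e !=set0.
    apply: ul; last exact: nbhsx_ballx.
    by apply: (@filterS _ U _ _ _ _ Ul) => k klt; exists k.
  by rewrite -ball_normE.
have /choice[L LP] := Lcvg.
have [w wP] : exists w, forall v, L v = inner w v.
  apply: (@Riesz L M) => [v v'|a v|v].
  - have LDv : inner (u k) (v + v') @[k --> U] --> L v + L v'.
      by under eq_fun do rewrite innerDr; apply: cvgD.
    exact: (cvg_unique _ (LP _) LDv).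
  - have LZv : inner (u k) (a *: v) @[k --> U] --> a * L v.
      by under eq_fun do rewrite innerZr; apply: cvgMr.
    exact: (cvg_unique _ (LP _) LZv).
  - apply: (cvgr_to_le (cvg_norm (LP v))); near=> k.
    by apply: le_trans (CauchySchwarz_inner _ _) _; rewrite ler_wpM2r.
pose b k := u k - w.
have b0 v (e : R) : 0 < e -> U [set k | `|inner (b k) v| < e].
  move=> e0; have /cvgrPdist_lt/(_ _ e0) := LP v; apply: filterS => k.
  by rewrite /= /b innerBl wP distrC.
(* Beyond any [n] there is an index whose deviation is almost orthogonal to all the deviations up to
   [n], since finitely many sets of [U] meet. Iterating [f] gives the subsequence. *)
have [f fP] : {f : nat -> nat & forall n, (n < f n)%N /\
    forall m, (m <= n)%N -> `|inner (b (f n)) (b m)| < n.+1%:R^-1}.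
  apply: (@choice _ _ (fun n k => (n < k)%N /\
    forall m, (m <= n)%N -> `|inner (b k) (b m)| < n.+1%:R^-1)) => n.
  have n0 : 0 < n.+1%:R^-1 :> R by rewrite invr_gt0.
  have Un p : U [set k | forall m, (m <= p)%N -> `|inner (b k) (b m)| < n.+1%:R^-1].
    elim: p => [|p IHp].
      by apply: filterS (b0 (b 0) _ n0) => k ? m; rewrite leqn0 => /eqP ->.
    apply: filterS (filterI IHp (b0 (b p.+1) _ n0)) => k [kp kp1] m.
    by rewrite leq_eqVlt => /predU1P[->//|]; exact: kp.
  have Ugt : U [set k | (n < k)%N] by apply: UF; exists n.+1.
  by have [k []] := filter_ex (filterI Ugt (Un n)); exists k.
pose phi j := iter j f 0%N.
have phi_lt i : (phi i < phi i.+1)%N by have [] := fP (phi i).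
have phi_ge i : (i <= phi i)%N by elim: i => // i /leq_ltn_trans; apply.
have phi_mono : {homo phi : i j / (i <= j)%N}.
  by apply: homo_leq => [//|? ? ?|i]; [exact: leq_trans|exact: ltnW].
exists phi, w; split=> // v; apply/(@cvgrPdist_lt _ R^o) => e e0.
have : weak_cvg (b \o phi) 0.
  apply: (@almost_orthogonal_weak_cvg0 _ (M + `|w|)) => [j|i].
    by apply: le_trans (ler_normB _ _) _; rewrite lerD2r.
  apply/cvgr0Pnorm_lt => d d0; have [N NP] := invS_small d0.
  (* The term of index [j.+1] is controlled by the choice made at [phi j], hence the shift by
     one. *)
  exists (maxn N i).+1 => // -[//|j] /=; rewrite ltnS geq_max => /andP[Nj ij].
  have [_ /(_ (phi i) (phi_mono _ _ ij))] := fP (phi j).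
  move=> /lt_trans; apply; apply: NP; exact: leq_trans Nj (phi_ge j).
move=> /(_ v); rewrite inner0l => /cvgr0Pnorm_lt/(_ _ e0).
by apply: filterS => k; rewrite /= innerBl distrC.
Unshelve. all: by end_near. Qed.

(** Uniform boundedness for the functionals [inner (u k)], evaluated at the normalized vectors
    [u k]. *)
Lemma weak_cvg_bounded u w : weak_cvg u w ->
  exists2 M : R, 0 <= M & forall k, `|u k| <= M.
Proof.
move=> uw.
pose F := [set f : X -> R^o | exists k, f = inner (u k)].
have [] := @Banach_Steinhauss R X R^o F _ _ 1.
- move=> _ [k ->]; split; last by move=> a x y; rewrite innerDr innerZr.
  move=> r; exists (`|u k| * r) => x xr.
  by apply: le_trans (CauchySchwarz_inner _ _) _; rewrite ler_wpM2l.
- move=> x; have /cvg_seq_bounded := cvgP _ (uw x).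
  rewrite /bounded_fun /bounded_near => -[M [_ MP]].
  exists (M + 1) => _ [k ->]; by apply: (MP (M + 1)); rewrite ?ltrDl.
- move=> M MP; exists (Num.max 0 M); first by rewrite le_max lexx.
  move=> k; have [->|u0] := eqVneq (u k) 0; first by rewrite normr0 le_max lexx.
  rewrite le_max; apply/orP; right.
  have := MP _ (ex_intro _ k erefl) (`|u k|^-1 *: u k).
  rewrite innerZr innerxx expr2 mulKf ?normr_eq0// normr_id; apply.
  by rewrite normrZ normfV normr_id mulVf ?normr_eq0.
Qed.

End weak_compactness.

(** * Variational principle, tangent cones and approximate normals *)

Section Ekeland.
Context {R : realType} {V : normedModType R}.

(** Each step of the sequence nearly minimizes [f] over the set [S] of the previous point. The limit
    lies in all these sets, and a point violating the last claim would too, with a value of [f] too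
    small. The same [d] serves as slope and as radius because [f a <= d ^+ 2]. *)
Lemma Ekeland (A : set V) (f : V -> R) (a : V) (d : R) :
  sequentially_complete V ->
  closed A -> A a -> continuous f -> (forall u, A u -> 0 <= f u) ->
  0 < d -> f a <= d ^+ 2 ->
  exists w, [/\ A w, `|w - a| <= d & forall u, A u -> f w <= f u + d * `|u - w|].
Proof.
move=> Vcomplete Acl Aa fC f0 d0 fa.
pose S u := [set v | A v /\ f v + d * `|v - u| <= f u].
have S_refl u : A u -> S u u by move=> Au; split; rewrite // subrr normr0 mulr0 addr0.
have S_trans u v w : S u v -> S v w -> S u w.
  move=> [Av uv] [Aw vw]; split => //.
  have : d * `|w - u| <= d * `|w - v| + d * `|v - u|.
    by rewrite -mulrDr ler_pM2l// (le_trans _ (ler_normD _ _))// addrA subrK.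
  by lra.
have [g gP] : {g : nat * V -> V & forall p, A p.2 -> S p.2 (g p) /\
    forall v, S p.2 v -> f (g p) <= f v + p.1.+1%:R^-1}.
  apply: (@choice _ _ (fun p v => A p.2 -> S p.2 v /\
    forall v', S p.2 v' -> f v <= f v' + p.1.+1%:R^-1)) => -[n u] /=.
  (* Off [A] nothing is required, and [a] is a default value. *)
  have [Au|] := pselect (A u); last by exists a.
  have Sinf : has_inf (f @` S u).
    split; first by exists (f u), u => //; exact: S_refl.
    by exists 0 => _ [v [Av _] <-]; exact: f0.
  have n0 : 0 < n.+1%:R^-1 :> R by rewrite invr_gt0.
  have [_ [v Sv <-] /ltW vP] := inf_adherent n0 Sinf.
  exists v => _; split=> // v' Sv'; apply: le_trans vP _; rewrite lerD2r.
  by apply: ge_inf; [exact: Sinf.2|exists v'].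
pose x := fix x n := if n is m.+1 then g (m, x m) else a.
have Ax n : A (x n) by elim: n => //= n IHn; have [[]] := gP (n, x n) IHn.
have Sx n : S (x n) (x n.+1) by have [] := gP (n, x n) (Ax n).
have xmin n v : S (x n) v -> f (x n.+1) <= f v + n.+1%:R^-1.
  by have [_ ] := gP (n, x n) (Ax n); apply.
have Sx_le n m : (n <= m)%N -> S (x n) (x m).
  move=> /subnK <-; elim: (m - n)%N => [|k IHk]; first exact: S_refl.
  by rewrite addSn; exact: S_trans (Sx _).
have fx_inf : has_inf (range (f \o x)).
  by split; [exists (f a), 0%N|exists 0 => _ [n _ <-]; exact: f0].
have xC : cauchy_sequence x.
  move=> e e0; have ed : 0 < e * d / 2 by rewrite !mulr_gt0.
  have [_ [N _ <-] NP] := inf_adherent ed fx_inf.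
  have xN m : (N <= m)%N -> `|x m - x N| <= e / 2.
    move=> /Sx_le[_ xNm]; rewrite -(ler_pM2l d0).
    have : inf (range (f \o x)) <= f (x m) by apply: ge_inf; [exact: fx_inf.2|exists m].
    rewrite /= in NP; move: (inf _) NP => i NP ?; lra.
  exists N => m n /xN mN /xN nN.
  rewrite -[_ - _](subrKA (x N)) (le_trans (ler_normD _ _))//.
  by rewrite (distrC (x N)); lra.
have /cvg_ex[w xw] := Vcomplete _ xC.
have Aw : A w by apply: (@closed_cvg _ _ \oo _ x A Acl _ w xw); exact: nearW.
have Sw n : S (x n) w.
  split=> //.
  have cv : f (x m) + d * `|x m - x n| @[m --> \oo] --> f w + d * `|w - x n|.
    apply: cvgD; first by apply: (@cvg_comp _ _ _ x f _ _ _ xw); exact: fC.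
    apply: cvgM; first exact: cvg_cst.
    by apply: cvg_norm; apply: cvgB => //; exact: cvg_cst.
  apply: (cvgr_to_le cv); near=> m.
  have nm : (n <= m)%N by near: m; exact: nbhs_infty_ge.
  by have [] := Sx_le _ _ nm.
exists w; split => //.
  have [_] := Sw 0%N; rewrite /= => aw; rewrite -(ler_pM2l d0).
  by have := f0 _ Aw; rewrite expr2 in fa; lra.
move=> u Au; rewrite leNgt; apply/negP => uw.
have Su n : S (x n) u by apply: S_trans (Sw n) _; split=> //; exact: ltW.
have duw : 0 <= d * `|u - w| by rewrite mulr_ge0// ltW.
have [|N NP] := @invS_small R (f w - f u); first by lra.
have := NP N (leqnn _); have := xmin N u (Su N); have [_] := Sw N.+1.
have : 0 <= d * `|w - x N.+1| by rewrite mulr_ge0// ltW.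
move: (N.+1%:R^-1) => i; lra.
Unshelve. all: by end_near. Qed.

End Ekeland.

(** * Tangent cones of convex sets *)

Section tangent_cone.
Context {R : realType} {X : hilbertType R}.
Implicit Types (Om : set X) (x w : X).

Lemma tangent_coneZ Om x (a : R) w : 0 < a ->
  tangent_cone Om x w -> tangent_cone Om x (a *: w).
Proof.
move=> a0 [t [ws [t0 tc wsc tP]]]; exists (fun k => t k / a), (fun k => a *: ws k).
split.
- by move=> k; rewrite divr_gt0.
- by rewrite -[0](mul0r a^-1); apply: cvgM => //; exact: cvg_cst.
- by apply: cvgZ => //; exact: cvg_cst.
- by move=> k; rewrite scalerA mulfVK// gt_eqF.
Qed.

(** Trades a tangent vector for a difference quotient towards a fixed point [x'] of [Om]. Unlike the
    vector itself, such a quotient can be moved to another base point of a convex set. *)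
Lemma tangent_cone_approx Om x w (e : R) : tangent_cone Om x w -> 0 < e ->
  exists x' (t : R), [/\ Om x', 0 < t & `|t^-1 *: (x' - x) - w| <= e].
Proof.
move=> [t [ws [t0 tc wsc tP]]] e0.
have [N _ NP] : \forall k \near \oo, `|w - ws k| <= e by move/cvgrPdist_le : wsc; exact.
exists (x + t N *: ws N), (t N); split => //.
by rewrite addrAC subrr add0r scalerA mulVf ?gt_eqF// scale1r distrC NP/=.
Qed.

Context {Om : set X} (Om_convex : convex_set (Om : set (convex_lmodType X))).

Lemma convex_set_segment x y (t : R) : Om x -> Om y -> 0 <= t -> t <= 1 ->
  Om (x + t *: (y - x)).
Proof.
move=> Ox Oy t0 t1; have := @Om_convex y x (Itv01 t0 t1); rewrite !inE.
move=> /(_ Oy Ox); congr (Om _).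
by rewrite /conv/= /unstable.onem scalerBl scale1r scalerBr addrCA.
Qed.

(** Scaled by [s^-1], the vector leads from [x] to a point of [Om]; by convexity the whole segment
    to that point lies in [Om]. *)
Lemma tangent_cone_radial x x' x'' (a b : R) : Om x -> Om x' -> Om x'' ->
  0 <= a -> 0 <= b -> tangent_cone Om x (a *: (x' - x) + b *: (x'' - x)).
Proof.
move=> Ox Ox' Ox'' a0 b0.
pose w := a *: (x' - x) + b *: (x'' - x).
(* The added 1 keeps [s] positive when [a] and [b] both vanish. *)
pose s := a + b + 1; have s0 : 0 < s by rewrite ltr_wpDl// addr_ge0.
have Osw : Om (x + s^-1 *: w).
  have [ab|ab] := eqVneq (a + b) 0.
    have [a00 b00] : a = 0 /\ b = 0 by split; lra.
    by rewrite /w a00 b00 !scale0r addr0 scaler0 addr0.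
  have ab0 : 0 < a + b by rewrite lt_neqAle eq_sym ab addr_ge0.
  (* The mean of [x'] and [x''] with weights [a] and [b], so that [w] is [(a + b) *: (y - x)]. *)
  pose y := x'' + (a / (a + b)) *: (x' - x'').
  have Oy : Om y.
    apply: convex_set_segment => //; first by rewrite divr_ge0// ltW.
    by rewrite ler_pdivrMr// mul1r lerDl.
  have -> : s^-1 *: w = ((a + b) / s) *: (y - x).
    rewrite /w /y addrAC (_ : x' - x'' = (x' - x) - (x'' - x)); last first.
      by rewrite opprB addrA subrK.
    move: (x' - x) (x'' - x) => X1 X2.
    rewrite !scalerDr !scalerN !scalerA.
    rewrite (_ : (a + b) / s * (a / (a + b)) = s^-1 * a); last first.
      by field; rewrite ab gt_eqF.
    rewrite addrCA -scalerBl; congr (_ *: _ + _ *: _).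
    by field; rewrite gt_eqF.
  apply: convex_set_segment => //; first by rewrite divr_ge0// ltW.
  by rewrite ler_pdivrMr// mul1r lerDl.
exists (fun k => s^-1 * k.+1%:R^-1), (fun=> w); split => //.
- by move=> k; rewrite mulr_gt0 ?invr_gt0.
- rewrite -[X in _ --> X](mulr0 s^-1); apply: cvgM; first exact: cvg_cst.
  exact: cvg_harmonic.
- exact: cvg_cst.
- move=> k; rewrite mulrC -scalerA -[s^-1 *: w](addKr x) (addrC (- x)).
  by apply: convex_set_segment => //; rewrite ?invr_ge0// invf_le1// ler1n.
Qed.

End tangent_cone.

(** * Approximate normals with an absolute error *)

Section approx_normal.
Context {R : realType} {X Y : hilbertType R}.
Implicit Types (A : set (X * Y)) (p q z : X * Y) (a e : R).

Lemma prod_norm_ge0 p : 0 <= prod_norm p.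
Proof. exact: sqrtr_ge0. Qed.

Lemma sqr_prod_norm p : prod_norm p ^+ 2 = `|p.1| ^+ 2 + `|p.2| ^+ 2.
Proof. by rewrite sqr_sqrtr /prod_inner ?innerxx// addr_ge0// inner_ge0. Qed.

Lemma le_fst_prod_norm p : `|p.1| <= prod_norm p.
Proof. by rewrite -ler_sqr ?nnegrE ?prod_norm_ge0// sqr_prod_norm lerDl sqr_ge0. Qed.

Lemma le_snd_prod_norm p : `|p.2| <= prod_norm p.
Proof. by rewrite -ler_sqr ?nnegrE ?prod_norm_ge0// sqr_prod_norm lerDr sqr_ge0. Qed.

Lemma prod_norm_leD p : prod_norm p <= `|p.1| + `|p.2|.
Proof.
rewrite -ler_sqr ?nnegrE ?prod_norm_ge0 ?addr_ge0// sqr_prod_norm.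
by have := mulr_ge0 (normr_ge0 p.1) (normr_ge0 p.2); lra.
Qed.

Lemma norm_le_prod_norm p : `|p| <= prod_norm p.
Proof. by rewrite prod_normE ge_max le_fst_prod_norm le_snd_prod_norm. Qed.

Lemma prod_norm_le2 p : prod_norm p <= 2 * `|p|.
Proof.
apply: le_trans (prod_norm_leD p) _.
rewrite prod_normE mulrDl mul1r lerD// le_max lexx ?orbT//.
Qed.

Lemma prod_innerZl a p q : prod_inner (a *: p) q = a * prod_inner p q.
Proof. by rewrite /prod_inner /= !innerZl mulrDr. Qed.

Lemma prod_norm0 : prod_norm (0 : X * Y) = 0.
Proof. by rewrite /prod_norm /prod_inner/= !inner0l addr0 sqrtr0. Qed.

(** The error [e] is absolute, whereas in [eps_normal] it is relative to the norm of the functional.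
    Absolute errors survive small changes of the functional and scale along with it. *)
Definition approx_normal e A z zs := exists2 r : R, 0 < r &
  forall z', A z' -> `|z' - z| < r ->
    prod_inner zs (z' - z) <= e * prod_norm (z' - z).

Lemma approx_normalZ e A z zs a : 0 < a ->
  approx_normal e A z zs -> approx_normal (a * e) A z (a *: zs).
Proof.
move=> a0 [r r0 H]; exists r => // z' Az' z'z.
by rewrite prod_innerZl -mulrA ler_pM2l// H.
Qed.

(** A bound on a limsup holds on a whole punctured neighbourhood only up to a slack, here [d]. *)
Lemma eps_normal_approx e A z zs (d : R) : eps_normal e A z zs -> 0 < d ->
  approx_normal (e * prod_norm zs + d) A z zs.
Proof.
rewrite /eps_normal /= limf_esupE => H d0.
have : (ereal_inf [set ereal_sup ((fun z' =>
    (prod_inner zs (z' - z) / prod_norm (z' - z))%:E) @` V) | V in within A z^']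
    < (e * prod_norm zs + d)%:E)%E.
  by apply: le_lt_trans H _; rewrite lte_fin ltrDl.
move=> /ereal_inf_lt[_ [V AV <-] Vlt].
have /nbhs_ballP[r /= r0 rP] : \forall z' \near z, z' != z -> A z' -> V z'.
  exact: AV.
exists r => // z' Az' z'z; have [->|z'Nz] := eqVneq z' z.
  by rewrite subrr prod_norm0 mulr0 /prod_inner/= !inner0r addr0.
have zz0 : 0 < prod_norm (z' - z).
  by apply: lt_le_trans (norm_le_prod_norm _); rewrite normr_gt0 subr_eq0.
rewrite -ler_pdivrMr// -lee_fin; apply/ltW; apply: le_lt_trans Vlt.
apply: ereal_sup_ubound; exists z' => //; apply: rP => //=.
by rewrite -ball_normE/= distrC.
Qed.

Lemma approx_eps_normal e a A z zs : approx_normal e A z zs ->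
  e <= a * prod_norm zs -> eps_normal a A z zs.
Proof.
move=> [r r0 H] ea; rewrite /eps_normal /= limf_esupE.
apply: ge_ereal_inf.
exists (ereal_sup ((fun z' =>
    (prod_inner zs (z' - z) / prod_norm (z' - z))%:E) @`
    [set z' | [/\ A z', z' != z & `|z' - z| < r]])).
  exists [set z' | [/\ A z', z' != z & `|z' - z| < r]] => //.
  apply/nbhs_ballP; exists r => //= z' zz' z'z Az'; split => //.
  by move: zz'; rewrite -ball_normE/= distrC.
apply: ub_ereal_sup => _ [z' [Az' z'Nz z'z] <-]; rewrite lee_fin.
have zz0 : 0 < prod_norm (z' - z).
  by apply: lt_le_trans (norm_le_prod_norm _); rewrite normr_gt0 subr_eq0.
by rewrite ler_pdivrMr// (le_trans (H _ Az' z'z))// ler_wpM2r// ltW.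
Qed.

End approx_normal.

Section prod_complete.
Context {R : realType}.

Lemma sequentially_complete_prod (V W : normedModType R) :
  sequentially_complete V -> sequentially_complete W ->
  sequentially_complete (V * W)%type.
Proof.
move=> HV HW u uC.
have /HV/cvg_ex[v uv] : cauchy_sequence (fun n => (u n).1).
  move=> e e0; have [N NP] := uC e e0; exists N => m n Nm Nn.
  by apply: le_trans (NP m n Nm Nn); rewrite prod_normE le_max lexx.
have /HW/cvg_ex[w uw] : cauchy_sequence (fun n => (u n).2).
  move=> e e0; have [N NP] := uC e e0; exists N => m n Nm Nn.
  by apply: le_trans (NP m n Nm Nn); rewrite prod_normE le_max lexx orbT.
apply/cvg_ex; exists (v, w).
have -> : u = (fun n => ((u n).1, (u n).2)) by apply/funext => n; case: (u n).
exact: cvg_pair.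
Qed.

End prod_complete.

(** * The penalty function and its first-order expansion *)

Section penalty.
Context {R : realType} {X : hilbertType R}.
Implicit Types (a e : X) (h : R).

Definition penalty a h : R := Num.sqrt (`|a| ^+ 2 + Num.max h 0 ^+ 2).

Lemma penalty_ge0 a h : 0 <= penalty a h.
Proof. exact: sqrtr_ge0. Qed.

Lemma sqr_penalty a h : penalty a h ^+ 2 = `|a| ^+ 2 + Num.max h 0 ^+ 2.
Proof. by rewrite sqr_sqrtr// addr_ge0// sqr_ge0. Qed.

Lemma penalty_gt0 a h : a != 0 \/ 0 < h -> 0 < penalty a h.
Proof.
move=> ah; rewrite sqrtr_gt0; case: ah => [a0|h0].
  by rewrite ltr_pwDl ?sqr_ge0// exprn_gt0// normr_gt0.
by rewrite ltr_wpDl ?sqr_ge0// exprn_gt0// lt_max h0.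
Qed.

(** With [s] and [s'] the two penalties, [s <= s' + r] and [2 s s' <= s^2 + s'^2] give
    [(s^2 - s'^2) / 2 <= s r]. The squared penalty is then bounded by its second-order expansion, so
    the root is never differentiated. *)
Lemma penalty_first_order a e h h' (r : R) :
  penalty a h <= penalty (a + e) h' + r ->
  - (inner a e + Num.max h 0 * (h' - h)) <=
    penalty a h * r + (`|e| ^+ 2 + (h' - h) ^+ 2) / 2.
Proof.
move=> le_r; have s0 := penalty_ge0 a h.
(* The squared positive part has derivative [2 * Num.max h 0], which is 2-Lipschitz. *)
have maxP : Num.max h' 0 ^+ 2 <=
    Num.max h 0 ^+ 2 + 2 * Num.max h 0 * (h' - h) + (h' - h) ^+ 2.
  have := sqr_ge0 h'; have := sqr_ge0 (h' - h); have := sqr_ge0 h.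
  have [h'0|h'0] := leP h' 0; have [h0|h0] := leP h 0 => ? ? ?; try lra.
  by have := mulr_ge0 (ltW h'0) (_ : 0 <= - h); rewrite oppr_ge0 => /(_ h0); lra.
have := sqr_penalty (a + e) h'; rewrite sqr_normD.
have := sqr_penalty a h.
have := sqr_ge0 (penalty (a + e) h' - penalty a h).
have := ler_wpM2l s0 le_r.
move: maxP; move: (penalty a h) (penalty (a + e) h') => s s'.
move: (Num.max h' 0 ^+ 2) (Num.max h 0) (inner a e) => *; nra.
Qed.

Lemma continuous_penalty (T : topologicalType) (a : T -> X) (h : T -> R) :
  continuous a -> continuous h -> continuous (fun x => penalty (a x) (h x)).
Proof.
move=> ac hc x; rewrite /penalty.
apply: (@cvg_comp _ _ _ _ Num.sqrt); last exact: sqrt_continuous.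
apply: cvgD.
  by rewrite expr2; under eq_fun do rewrite expr2; apply: cvgM; apply: cvg_norm; exact: ac.
have maxc : Num.max (h y) 0 @[y --> x] --> Num.max (h x) 0.
  rewrite maxr_absE; under eq_fun do rewrite maxr_absE !(addr0, subr0).
  rewrite addr0 subr0; apply: cvgM; last exact: cvg_cst.
  by apply: cvgD; [exact: hc|apply: cvg_norm; exact: hc].
by rewrite expr2; under eq_fun do rewrite expr2; exact: cvgM.
Qed.

End penalty.

(** * The fuzzy sum rule *)

Section fuzzy_sum_rule.
Context {R : realType} {X Y : hilbertType R}.

Lemma fuzzy_sum_rule (Om : set X) (L1 L2 V1 V2 : set (X * Y)) (xh : X)
    (y1h y2h : Y) (xs : X) (ys : Y) (c eta r : R) :
  convex_set (Om : set (convex_lmodType X)) ->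
  (forall u, L1 u -> Om u.1) -> (forall u, L2 u -> Om u.1) ->
  L1 (xh, y1h) -> L2 (xh, y2h) ->
  nbhs (xh, y1h) V1 -> nbhs (xh, y2h) V2 ->
  closed (L1 `&` V1) -> closed (L2 `&` V2) ->
  tangent_cone Om xh xs -> 0 <= c -> 0 < eta -> 0 < r ->
  (forall x y1 y2, L1 (x, y1) -> L2 (x, y2) ->
    `|x - xh| < r -> `|y1 - y1h| < r -> `|y2 - y2h| < r ->
    inner xs (x - xh) - inner ys (y1 - y1h) - inner ys (y2 - y2h) <=
      c * (`|x - xh| + `|y1 - y1h| + `|y2 - y2h|)) ->
  exists u1 u2 (lam : R) (a p : X),
    [/\ L1 u1, L2 u2, `|u1 - (xh, y1h)| <= eta & `|u2 - (xh, y2h)| <= eta] /\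
    [/\ 0 <= lam, `|p| ^+ 2 + lam ^+ 2 = 1 & `|a - (lam *: xs - p)| <= eta] /\
    [/\ tangent_cone Om u1.1 a, tangent_cone Om u2.1 p,
        approx_normal (2 * c + eta) L1 u1 (a, - (lam *: ys)) &
        approx_normal (2 * c + eta) L2 u2 (p, - (lam *: ys))].
Proof.
move=> cvxOm L1Om L2Om L1h L2h V1h V2h L1V1 L2V2 Txs c0 eta0 r0 normal_xs.
have [||x' [tau [Omx' tau0 x'xs]]] := @tangent_cone_approx R X Om xh xs (eta / 8).
- by [].
- by rewrite divr_gt0.
have /nbhs_ballP[r1 /= r10 r1V1] := V1h.
have /nbhs_ballP[r2 /= r20 r2V2] := V2h.
(* [d < r] lets the hypothesis apply at the Ekeland point, [d < r1] and [d < r2] leave room inside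
   [V1] and [V2], [d <= eta / 8] bounds the Ekeland slope, and the last bound makes a change of base
   point in the quotient of step [tau] cost at most [eta / 8]. *)
have [d [d0 dr [dr1 dr2] deta dtau]] : exists d : R,
    [/\ 0 < d, d < r, d < r1 /\ d < r2, d <= eta / 8 & d <= tau * (eta / 8)].
  have e8 : 0 < eta / 8 by rewrite divr_gt0.
  have te8 : 0 < tau * (eta / 8) by rewrite mulr_gt0.
  pose m := Num.min (Num.min r (Num.min r1 r2)) (Num.min (eta / 8) (tau * (eta / 8))).
  have m0 : 0 < m by rewrite !lt_min r0 r10 r20 e8 te8.
  have mm : m / 2 < m by lra.
  have : m <= m by []; rewrite {2}/m !le_min => /and3P[].
  move=> /and3P[mr mr1 mr2] me mt.
  by exists (m / 2); clear -m0 mm mr mr1 mr2 me mt; split; [lra|lra|split; lra|lra|lra].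
(* By hypothesis [g] is nonnegative near [zh] at pairs with equal first components. It reads the
   first component only from the first graph, so [xs] will enter only the normal to [L1]. Adding
   [d ^+ 2] gives [f] the value [d ^+ 2] at [zh]. *)
pose g (z : (X * Y) * (X * Y)) : R := - inner xs (z.1.1 - xh) +
  inner ys (z.1.2 - y1h) + inner ys (z.2.2 - y2h) +
  c * (`|z.1.1 - xh| + `|z.1.2 - y1h| + `|z.2.2 - y2h|).
pose f (z : (X * Y) * (X * Y)) := penalty (z.1.1 - z.2.1) (g z + d ^+ 2).
pose zh : (X * Y) * (X * Y) := ((xh, y1h), (xh, y2h)).
pose A : set ((X * Y) * (X * Y)) := (L1 `&` V1) `*` (L2 `&` V2).
have fh : f zh = d ^+ 2.
  rewrite /f /penalty /g /zh /= !subrr !inner0r oppr0 !normr0 !add0r mulr0 add0r.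
  by rewrite expr0n add0r max_l ?sqr_ge0// sqrtr_sqr ger0_norm// sqr_ge0.
have fC : continuous f.
  have c11 : continuous (fun z : (X * Y) * (X * Y) => z.1.1).
    by move=> z; apply: (@cvg_comp _ _ _ fst fst); exact: cvg_fst.
  have c12 : continuous (fun z : (X * Y) * (X * Y) => z.1.2).
    by move=> z; apply: (@cvg_comp _ _ _ fst snd); [exact: cvg_fst|exact: cvg_snd].
  have c21 : continuous (fun z : (X * Y) * (X * Y) => z.2.1).
    by move=> z; apply: (@cvg_comp _ _ _ snd fst); [exact: cvg_snd|exact: cvg_fst].
  have c22 : continuous (fun z : (X * Y) * (X * Y) => z.2.2).
    by move=> z; apply: (@cvg_comp _ _ _ snd snd); exact: cvg_snd.
  apply: continuous_penalty => z; first by apply: cvgB; [exact: c11|exact: c21].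
  have b11 : z'.1.1 - xh @[z' --> z] --> z.1.1 - xh.
    by apply: cvgB; [exact: c11|exact: cvg_cst].
  have b12 : z'.1.2 - y1h @[z' --> z] --> z.1.2 - y1h.
    by apply: cvgB; [exact: c12|exact: cvg_cst].
  have b22 : z'.2.2 - y2h @[z' --> z] --> z.2.2 - y2h.
    by apply: cvgB; [exact: c22|exact: cvg_cst].
  apply: cvgD; last exact: cvg_cst.
  apply: cvgD; first apply: cvgD; first apply: cvgD.
  - by apply: cvgN; exact: cvg_innerr.
  - exact: cvg_innerr.
  - exact: cvg_innerr.
  - apply: cvgM; first exact: cvg_cst.
    by apply: cvgD; [apply: cvgD|]; exact: cvg_norm.
have [|||||||w [[[L1w V1w] [L2w V2w]] wd wmin]] := @Ekeland R _ A f zh d.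
- by do 2 apply: sequentially_complete_prod; apply: complete_sequentially_complete.
- have -> : A = (fst @^-1` (L1 `&` V1)) `&` (snd @^-1` (L2 `&` V2)) by [].
  by apply: closedI; apply: closed_comp => // z _; [exact: cvg_fst|exact: cvg_snd].
- by split; split => //; exact: nbhs_singleton.
- exact: fC.
- by move=> u _; exact: penalty_ge0.
- exact: d0.
- by rewrite fh.
pose D := w.1.1 - w.2.1; pose h := g w + d ^+ 2; pose psi := f w.
(* If the first components agree, then [g w] is nonnegative and [h] is at least [d ^+ 2]. *)
have psi0 : 0 < psi.
  apply: penalty_gt0; have [/subr0_eq D0|] := eqVneq D 0; last by left.
  right; rewrite ltr_wpDl// ?exprn_gt0//.
  have w11 : `|w.1.1 - xh| <= d by apply: le_trans wd; rewrite !(prod_normE, le_max) lexx.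
  have w12 : `|w.1.2 - y1h| <= d.
    by apply: le_trans wd; rewrite !(prod_normE, le_max) lexx orbT.
  have w22 : `|w.2.2 - y2h| <= d.
    by apply: le_trans wd; rewrite !(prod_normE, le_max) lexx !orbT.
  have := normal_xs w.1.1 w.1.2 w.2.2; rewrite -surjective_pairing D0 -surjective_pairing.
  rewrite -D0 => /(_ L1w L2w (le_lt_trans w11 dr) (le_lt_trans w12 dr) (le_lt_trans w22 dr)).
  by rewrite /g; lra.
pose lam := Num.max h 0 / psi; pose p := psi^-1 *: D.
have lam0 : 0 <= lam by rewrite divr_ge0 ?le_max ?lexx ?orbT// ltW.
have plam : `|p| ^+ 2 + lam ^+ 2 = 1.
  rewrite normrZ exprMn real_normK ?num_real// /lam exprMn mulrC -mulrDl.
  by rewrite -sqr_penalty -exprMn divff ?expr1n// gt_eqF.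
have lam1 : lam <= 1.
  rewrite -(@ler_pXn2r _ 2) ?nnegrE// expr1n -plam lerDr sqr_ge0//.
(* [x' - w.1.1] replaces [x' - xh], to stay in the tangent cone at [w.1.1]. *)
pose a := (lam / tau) *: (x' - w.1.1) + psi^-1 *: (w.2.1 - w.1.1).
have Ta : tangent_cone Om w.1.1 a.
  apply: tangent_cone_radial => //; [exact: L1Om|exact: L2Om| |].
    by rewrite divr_ge0// ltW.
  by rewrite invr_ge0 ltW.
have Tp : tangent_cone Om w.2.1 p.
  rewrite -[p]addr0 -[X in _ + X](scale0r (x' - w.2.1)).
  apply: tangent_cone_radial => //; [exact: L2Om|exact: L1Om|].
  by rewrite invr_ge0 ltW.
have wd1 : `|w.1 - (xh, y1h)| <= d.
  by apply: le_trans wd; rewrite [leRHS]prod_normE le_max lexx.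
have wd2 : `|w.2 - (xh, y2h)| <= d.
  by apply: le_trans wd; rewrite [leRHS]prod_normE le_max lexx orbT.
(* One [eta / 8] comes from [x'] realizing [xs] only approximately, the other from moving the base
   point from [xh] to [w.1.1]. *)
have a_near : `|a - (lam *: xs - p)| <= eta / 4.
  have -> : a - (lam *: xs - p) =
      lam *: (tau^-1 *: (x' - xh) - xs - tau^-1 *: (w.1.1 - xh)).
    rewrite /a /p /D -(opprB w.1.1 w.2.1) scalerN opprB addrA subrK.
    rewrite addrAC -scalerBr [RHS]scalerBr scalerA; congr (_ *: _ - _).
    by rewrite opprB addrA subrK.
  rewrite normrZ ger0_norm//; apply: (@le_trans _ _ (1 * (eta / 8 + eta / 8))); last lra.
  rewrite ler_pM// (le_trans (ler_normB _ _))// lerD//.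
  rewrite normrZ ger0_norm ?invr_ge0 ?(ltW tau0)// ler_pdivrMl//.
  apply: le_trans dtau; apply: le_trans wd.
  by rewrite !(prod_normE, le_max) lexx.
(* The coefficient of the quadratic remainder after division by [psi]; [|xs| + |ys| + 2 * c] is a
   Lipschitz constant of [g] for moves of one graph point. *)
pose K := (1 + (`|xs| + `|ys| + 2 * c) ^+ 2) / (2 * psi).
have K0 : 0 < K by rewrite divr_gt0 ?mulr_gt0// ltr_pwDl// sqr_ge0.
(* Common to both graphs: [e] is the change of [D], [q] the linear part of the change of [g], and
   [N] the size of the move. The slope [d], the remainder [K * N] and the norm terms of [g],
   weighted by [lam <= 1], make up the error. *)
have key (z : (X * Y) * (X * Y)) (e : X) (q N : R) : A z -> 0 <= N ->
    z.1.1 - z.2.1 = D + e -> `|e| <= N -> `|z - w| <= N ->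
    `|g z - g w| <= (`|xs| + `|ys| + 2 * c) * N ->
    g z - g w <= q + 2 * c * N -> K * N <= eta / 4 ->
    - inner p e - lam * q <= (2 * c + eta / 2) * N.
  move=> Az N0 zD eN zw gL gq KN.
  have /penalty_first_order : penalty D h <= penalty (D + e) (g z + d ^+ 2) + d * N.
    rewrite -zD; apply: le_trans (wmin _ Az) _; rewrite lerD2l.
    by rewrite ler_wpM2l// ltW.
  rewrite -/(f w) -/psi.
  have -> : g z + d ^+ 2 - h = g z - g w by rewrite /h; clear; lra.
  have -> : inner D e = psi * inner p e.
    by rewrite /p innerZl mulrA divff ?mul1r// gt_eqF.
  have -> : Num.max h 0 = psi * lam by rewrite /lam mulrC divfK// gt_eqF.
  have eN2 : `|e| ^+ 2 <= N ^+ 2 by rewrite lerXn2r ?nnegrE.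
  have gL2 : (g z - g w) ^+ 2 <= ((`|xs| + `|ys| + 2 * c) * N) ^+ 2.
    by rewrite -real_normK ?num_real// lerXn2r ?nnegrE// (le_trans _ gL).
  move=> first_order.
  have : psi * (- inner p e - lam * (g z - g w)) <= psi * (d * N + K * N ^+ 2).
    have -> : psi * (d * N + K * N ^+ 2) =
        psi * (d * N) + (N ^+ 2 + ((`|xs| + `|ys| + 2 * c) * N) ^+ 2) / 2.
      by rewrite /K; field; rewrite gt_eqF.
    by clear -first_order eN2 gL2; lra.
  rewrite ler_pM2l//.
  have : lam * (g z - g w) <= lam * q + 2 * c * N.
    apply: le_trans (ler_wpM2l lam0 gq) _; rewrite mulrDr lerD2l.
    by rewrite -[leRHS]mul1r ler_wpM2r// !mulr_ge0.
  have : K * N ^+ 2 <= eta / 4 * N by rewrite expr2 mulrA ler_wpM2r.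
  have : d * N <= eta / 8 * N by rewrite ler_wpM2r.
  have : 0 <= eta * N by rewrite mulr_ge0// ltW.
  by clear; lra.
move: (K) K0 key => {}K K0 key.
have K8 : 0 < 8 * K by rewrite mulr_gt0.
have dist_lip (V : normedModType R) (u v b : V) :
    `|(`|u - b| - `|v - b|)| <= `|u - v|.
  by apply: le_trans (ler_dist_dist _ _) _; rewrite opprB addrA subrK.
(* Within [rho] the moved point stays in [V1] or [V2], and [K * N <= eta / 4]; the 8 absorbs the
   factor 2 between the Euclidean and max norms. *)
pose rho := Num.min (Num.min (r1 - d) (r2 - d)) (eta / (8 * K)).
have rho0 : 0 < rho by rewrite !lt_min !subr_gt0 dr1 dr2 divr_gt0.
have near_V (V : set (X * Y)) (u v : X * Y) (s : R) : `|u - v| <= d -> rho <= s - d ->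
    ball v s `<=` V -> forall z', `|z' - u| < rho -> V z'.
  move=> uv rs sV z' z'u; apply: sV; rewrite -ball_normE/= distrC.
  rewrite -(subrKA u) (le_lt_trans (ler_normD _ _))//; clear -uv z'u rs; lra.
have near_K (u z' : X * Y) : `|z' - u| < rho -> K * prod_norm (z' - u) <= eta / 4.
  move=> z'u; have : `|z' - u| <= eta / (8 * K).
    by apply: le_trans (ltW z'u) _; rewrite ge_min lexx orbT.
  rewrite ler_pdivlMr// => H.
  by have := ler_wpM2l (ltW K0) (prod_norm_le2 (z' - u)); clear -H; lra.
clearbody a p lam.
exists w.1, w.2, lam, a, p; split; first split => //.
- by apply: le_trans wd1 _; clear -deta eta0; lra.
- by apply: le_trans wd2 _; clear -deta eta0; lra.
split; first by split => //; apply: le_trans a_near _; clear -eta0; lra.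
split => //.
- exists rho => // z' L1z' z'w; set N := prod_norm _.
  have V1z' : V1 z'.
    by apply: (near_V V1 _ _ _ wd1 _ r1V1 _ z'w); rewrite /rho !ge_min lexx.
  have N0 : 0 <= N := prod_norm_ge0 _.
  have xN : `|z'.1 - w.1.1| <= N := le_fst_prod_norm (z' - w.1).
  have yN : `|z'.2 - w.1.2| <= N := le_snd_prod_norm (z' - w.1).
  have := dist_lip _ z'.1 w.1.1 xh; have := dist_lip _ z'.2 w.1.2 y1h.
  move=> /le_trans/(_ yN) + /le_trans/(_ xN); rewrite !ler_norml.
  move=> /andP[sy1 sy2] /andP[sx1 sx2].
  have cx1 := ler_wpM2l c0 sx1; have cx2 := ler_wpM2l c0 sx2.
  have cy1 := ler_wpM2l c0 sy1; have cy2 := ler_wpM2l c0 sy2.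
  have gE : g (z', w.2) - g w = - inner xs (z'.1 - w.1.1) + inner ys (z'.2 - w.1.2)
      + c * (`|z'.1 - xh| - `|w.1.1 - xh|) + c * (`|z'.2 - y1h| - `|w.1.2 - y1h|).
    by rewrite /g/= !innerBr; clear; lra.
  have := CauchySchwarz_inner xs (z'.1 - w.1.1).
  move=> /le_trans/(_ (ler_wpM2l (normr_ge0 _) xN)); rewrite ler_norml => /andP[xs1 xs2].
  have := CauchySchwarz_inner ys (z'.2 - w.1.2).
  move=> /le_trans/(_ (ler_wpM2l (normr_ge0 _) yN)); rewrite ler_norml => /andP[ys1 ys2].
  have := key (z', w.2) (z'.1 - w.1.1)
    (- inner xs (z'.1 - w.1.1) + inner ys (z'.2 - w.1.2)) N.
  rewrite gE /= => {}key.
  have {}key : - inner p (z'.1 - w.1.1) - lam * (- inner xs (z'.1 - w.1.1) +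
      inner ys (z'.2 - w.1.2)) <= (2 * c + eta / 2) * N.
    apply: key => //.
    - by rewrite /D [RHS]addrC subrKA.
    - by rewrite prod_normE /= subrr normr0 ge_max norm_le_prod_norm.
    - by rewrite ler_norml; apply/andP; split; clear -xs1 xs2 ys1 ys2 cx1 cx2 cy1 cy2; lra.
    - clear -cx2 cy2; lra.
    - exact: near_K.
  (* Passing from [lam *: xs - p] to the tangent vector [a] costs another [eta / 4]. *)
  have := le_trans (inner_le (a - (lam *: xs - p)) (z'.1 - w.1.1))
    (ler_pM (normr_ge0 _) (normr_ge0 _) a_near xN).
  have eN : 0 <= eta * N by rewrite mulr_ge0// ltW.
  rewrite !(innerBl, innerZl) => aN.
  change (inner a (z'.1 - w.1.1) + inner (- (lam *: ys)) (z'.2 - w.1.2) <= (2 * c + eta) * N).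
  rewrite innerNl innerZl; clear -aN eN key; lra.
- exists rho => // z' L2z' z'w; set N := prod_norm _.
  have V2z' : V2 z'.
    by apply: (near_V V2 _ _ _ wd2 _ r2V2 _ z'w); rewrite /rho !ge_min lexx ?orbT.
  have N0 : 0 <= N := prod_norm_ge0 _.
  have xN : `|z'.1 - w.2.1| <= N := le_fst_prod_norm (z' - w.2).
  have yN : `|z'.2 - w.2.2| <= N := le_snd_prod_norm (z' - w.2).
  have := dist_lip _ z'.2 w.2.2 y2h.
  move=> /le_trans/(_ yN); rewrite ler_norml => /andP[sy1 sy2].
  have cy1 := ler_wpM2l c0 sy1; have cy2 := ler_wpM2l c0 sy2.
  have gE : g (w.1, z') - g w = inner ys (z'.2 - w.2.2)
      + c * (`|z'.2 - y2h| - `|w.2.2 - y2h|).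
    by rewrite /g/= !innerBr; clear; lra.
  have := CauchySchwarz_inner ys (z'.2 - w.2.2).
  move=> /le_trans/(_ (ler_wpM2l (normr_ge0 _) yN)); rewrite ler_norml => /andP[ys1 ys2].
  (* Moving the second point changes [D] with the opposite sign, which is why [p] itself appears
     here. *)
  have := key (w.1, z') (- (z'.1 - w.2.1)) (inner ys (z'.2 - w.2.2)) N.
  rewrite gE /= => {}key.
  have xsN : 0 <= `|xs| * N by rewrite mulr_ge0.
  have cN : 0 <= c * N by rewrite mulr_ge0.
  have {}key : - inner p (- (z'.1 - w.2.1)) - lam * inner ys (z'.2 - w.2.2)
      <= (2 * c + eta / 2) * N.
    apply: key => //.
    - by rewrite /D opprB addrA subrK.
    - by rewrite normrN.
    - by rewrite prod_normE /= subrr normr0 ge_max norm_le_prod_norm andbT.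
    - by rewrite ler_norml; apply/andP; split; clear -ys1 ys2 cy1 cy2 xsN cN; lra.
    - clear -cy2 cN; lra.
    - exact: near_K.
  have eN : 0 <= eta * N by rewrite mulr_ge0// ltW.
  change (inner p (z'.1 - w.2.1) + inner (- (lam *: ys)) (z'.2 - w.2.2) <= (2 * c + eta) * N).
  rewrite innerNr in key; rewrite innerNl innerZl; clear -eN key; lra.
Qed.

End fuzzy_sum_rule.

(** * Passage to the limit *)

Section norm_convergence.
Context {R : realType} {V : normedModType R}.
Implicit Types (u v : nat -> V) (l : V).

Lemma cvg_perturb u v l : (fun k => v k - u k) @ \oo --> (0 : V) ->
  u @ \oo --> l -> v @ \oo --> l.
Proof.
move=> vu0 ul; rewrite -[l]add0r.
rewrite (_ : v = (fun k => v k - u k + u k)); first exact: cvgD.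
by apply/funext => k; rewrite subrK.
Qed.

Lemma cvg0_norm_le (d : nat -> R) u : (forall k, `|u k| <= d k) ->
  d @ \oo --> (0 : R) -> u @ \oo --> (0 : V).
Proof.
move=> ud d0; apply/cvgr0Pnorm_lt => e e0.
move/cvgr0Pnorm_lt : d0 => /(_ _ e0); apply: filterS => k.
by apply: le_lt_trans; apply: le_trans (ud k) (ler_norm _).
Qed.

End norm_convergence.

Section weak_convergence.
Context {R : realType} {X : hilbertType R}.
Implicit Types (u v : nat -> X) (l : X).

Lemma cvg_weak_cvg u l : u @ \oo --> l -> weak_cvg u l.
Proof. by move=> ul v; exact: cvg_innerl. Qed.

Lemma weak_cvg_subseq u l (phi : nat -> nat) : (forall k, (k <= phi k)%N) ->
  weak_cvg u l -> weak_cvg (u \o phi) l.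
Proof. by move=> phik ul v; apply: (cvg_subseq phik (ul v)). Qed.

Lemma weak_cvgB u v l l' : weak_cvg u l -> weak_cvg v l' ->
  weak_cvg (fun k => u k - v k) (l - l').
Proof.
move=> ul vl' w; rewrite innerBl; under eq_fun do rewrite innerBl.
by apply: cvgB; [exact: ul|exact: vl'].
Qed.

Lemma weak_cvgN u l : weak_cvg u l -> weak_cvg (fun k => - u k) (- l).
Proof.
move=> ul w; rewrite innerNl; under eq_fun do rewrite innerNl.
by apply: cvgN; exact: ul.
Qed.

Lemma weak_cvg_perturb u v l : (fun k => v k - u k) @ \oo --> (0 : X) ->
  weak_cvg u l -> weak_cvg v l.
Proof.
move=> vu0 ul; have := weak_cvgB ul (weak_cvgN (cvg_weak_cvg vu0)).
rewrite oppr0 subr0; congr weak_cvg; apply/funext => k.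
by rewrite opprK addrC subrK.
Qed.

End weak_convergence.

Section normal_sequences.
Context {R : realType} {X Y : hilbertType R}.
Context {Om : set X}.

Lemma tangent_cone0 x : Om x -> tangent_cone Om x 0.
Proof.
move=> Ox; exists (fun k => k.+1%:R^-1), (fun=> 0); split => //.
- exact: cvg_harmonic.
- exact: cvg_cst.
- by move=> k; rewrite scaler0 addr0.
Qed.

(* The bound in [eps_normal] is relative to the norm of the functional, so the
   functionals of norm at most [sqrt (e k)] have to be replaced by [0]. *)
Lemma approx_normal_seq (S : X -> set Y) xb yb (z : nat -> X * Y)
    (e : nat -> R) (xs : nat -> X) (ys : nat -> Y) :
  (forall k, 0 <= e k) -> e @ \oo --> (0 : R) ->
  (forall k, gph_on S Om (z k)) -> z @ \oo --> (xb, yb) ->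
  (forall k, approx_normal (e k) (gph_on S Om) (z k) (xs k, - ys k)) ->
  (forall k, tangent_cone Om (z k).1 (xs k)) ->
  exists eps xs' ys', [/\ normal_seq Om S xb yb eps z xs' ys',
    (fun k => xs' k - xs k) @ \oo --> (0 : X) &
    (fun k => ys' k - ys k) @ \oo --> (0 : Y)].
Proof.
move=> e0 ecvg zS zcvg apx tan.
(* A functional of norm above [sqrt e] satisfies [e <= eps * norm]; one below it is within [sqrt e]
   of 0, so replacing it changes no limit. *)
pose eps k := Num.sqrt (e k).
have eps_cvg : eps @ \oo --> (0 : R).
  rewrite -[X in _ --> X]sqrtr0.
  by apply: (@cvg_comp _ _ _ e Num.sqrt _ _ _ ecvg); exact: sqrt_continuous.
pose big k := eps k < prod_norm (xs k, - ys k).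
pose xs' k := if big k then xs k else 0.
pose ys' k := if big k then ys k else 0.
exists eps, xs', ys'; split.
- split => //; first by move=> k; exact: sqrtr_ge0.
  move=> k; rewrite /xs' /ys'; case: ifPn => [bk|_].
    split; last by split => //; exact: tan.
    apply: (approx_eps_normal (apx k)).
    rewrite -{1}(sqr_sqrtr (e0 k)) expr2 ler_wpM2l ?sqrtr_ge0//.
    exact: ltW.
  split; last by split => //; apply: tangent_cone0; exact: (zS k).1.
  apply: (@approx_eps_normal _ _ _ 0).
    exists 1 => // z' _ _.
    by rewrite /prod_inner/= oppr0 !inner0l addr0 mul0r.
  by rewrite mulr_ge0 ?sqrtr_ge0.
- apply: (cvg0_norm_le _ eps_cvg) => k; rewrite /xs'; case: ifPn => [_|].
    by rewrite subrr normr0 sqrtr_ge0.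
  rewrite -leNgt sub0r normrN; apply: le_trans.
  exact: (le_fst_prod_norm (xs k, - ys k)).
- apply: (cvg0_norm_le _ eps_cvg) => k; rewrite /ys'; case: ifPn => [_|].
    by rewrite subrr normr0 sqrtr_ge0.
  rewrite -leNgt sub0r; apply: le_trans.
  exact: (le_snd_prod_norm (xs k, - ys k)).
Qed.

End normal_sequences.

Section sum.
Context {R : realType} {X Y : hilbertType R}.
Context {Om : set X} (S1 S2 : X -> set Y).
Context (Om_closed : closed Om) (Om_convex : convex_set (Om : set (convex_lmodType X))).

Lemma closed_gph_on (S : X -> set Y) (V : set (X * Y)) :
  closed (gph_on S setT `&` V) -> closed (gph_on S Om `&` V).
Proof.
move=> SV.
have -> : gph_on S Om `&` V = (gph_on S setT `&` V) `&` (fst @^-1` Om).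
  by apply/seteqP; split => z /= [[]]; [|case].
by apply: closedI => //; apply: closed_comp => // z _; exact: cvg_fst.
Qed.

Lemma fuzzy_sum_map (V1 V2 : set (X * Y)) xh y1h y2h xs ys (eps eta : R) :
  Om xh -> S1 xh y1h -> S2 xh y2h ->
  nbhs (xh, y1h) V1 -> nbhs (xh, y2h) V2 ->
  closed (gph_on S1 setT `&` V1) -> closed (gph_on S2 setT `&` V2) ->
  0 <= eps -> 0 < eta ->
  eps_normal eps (gph_on (sum_map S1 S2) Om) (xh, y1h + y2h) (xs, - ys) ->
  tangent_cone Om xh xs ->
  exists (u1 u2 : X * Y) (lam : R) (a p : X),
    let e := 2 * (eps * prod_norm (xs, - ys) + eta) + eta in
    [/\ gph_on S1 Om u1, gph_on S2 Om u2,
        `|u1 - (xh, y1h)| <= eta & `|u2 - (xh, y2h)| <= eta] /\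
    [/\ 0 <= lam, `|p| ^+ 2 + lam ^+ 2 = 1 & `|a - (lam *: xs - p)| <= eta] /\
    [/\ tangent_cone Om u1.1 a, tangent_cone Om u2.1 p,
        approx_normal e (gph_on S1 Om) u1 (a, - (lam *: ys)) &
        approx_normal e (gph_on S2 Om) u2 (p, - (lam *: ys))].
Proof.
move=> Oxh S1h S2h V1h V2h S1V1 S2V2 eps0 eta0 nrm tan.
have c0 : 0 <= eps * prod_norm (xs, - ys) + eta.
  by rewrite addr_ge0 ?mulr_ge0 ?prod_norm_ge0// ltW.
have [r r0 rP] := eps_normal_approx nrm eta0.
(* The second component of the sum moves by two differences, each allowed half of [r]. *)
have r20 : 0 < r / 2 by rewrite divr_gt0.
apply: (@fuzzy_sum_rule R X Y Om _ _ V1 V2 xh y1h y2h xs ys _ eta (r / 2)) => //.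
- by move=> ? [].
- by move=> ? [].
- exact: closed_gph_on.
- exact: closed_gph_on.
- move=> x y1 y2 [/= Ox S1y1] [/= _ S2y2] xr y1r y2r.
  have E : (x, y1 + y2) - (xh, y1h + y2h) = (x - xh, (y1 - y1h) + (y2 - y2h)).
    by apply: injective_projections => //=; rewrite opprD addrACA.
  have y12 : `|(y1 - y1h) + (y2 - y2h)| <= `|y1 - y1h| + `|y2 - y2h| := ler_normD _ _.
  have := rP (x, y1 + y2); rewrite E => H.
  have /H{}H : gph_on (sum_map S1 S2) Om (x, y1 + y2).
    by split => //; exists y1 => //; exists y2.
  have /H : `|(x - xh, (y1 - y1h) + (y2 - y2h))| < r.
    rewrite prod_normE gt_max /=; apply/andP; split; clear -xr y1r y2r y12 r20; lra.
  rewrite {1}/prod_inner /= innerNl innerDr opprD addrA => /le_trans; apply.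
  rewrite ler_wpM2l// (le_trans (prod_norm_leD _))//= -[leRHS]addrA lerD2l; exact: y12.
Qed.


(** Inner semicontinuity splits the second component of [z k] into terms tending to [y1b] and [y2b].
    Then [fuzzy_sum_map] is applied at each index with tolerance [k.+1%:R^-1]. Weak convergence
    serves to bound [xs] and [ys], so that the errors vanish. *)
Lemma sum_map_multipliers xb yb y1b y2b (eps : nat -> R) z xs ys x y :
  inner_semicontinuous (sum_decomp S1 S2) (Om `*` [set: Y]) (xb, yb) (y1b, y2b) ->
  locally_closed_at (gph_on S1 setT) (xb, y1b) ->
  locally_closed_at (gph_on S2 setT) (xb, y2b) ->
  normal_seq Om (sum_map S1 S2) xb yb eps z xs ys ->
  weak_cvg xs x -> weak_cvg ys y ->
  exists (phi : nat -> nat) (u1 u2 : nat -> X * Y) (lam e : nat -> R)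
      (a p : nat -> X),
    [/\ forall k, (k <= phi k)%N,
        forall k, gph_on S1 Om (u1 k), forall k, gph_on S2 Om (u2 k),
        u1 @ \oo --> (xb, y1b) & u2 @ \oo --> (xb, y2b)] /\
    [/\ forall k, 0 <= e k, e @ \oo --> (0 : R),
        forall k, 0 <= lam k,
        forall k, `|p k| ^+ 2 + lam k ^+ 2 = 1 &
        (fun k => a k - (lam k *: xs (phi k) - p k)) @ \oo --> (0 : X)] /\
    [/\ forall k, tangent_cone Om (u1 k).1 (a k),
        forall k, tangent_cone Om (u2 k).1 (p k),
        forall k, approx_normal (e k) (gph_on S1 Om) (u1 k)
                    (a k, - (lam k *: ys (phi k))) &
        forall k, approx_normal (e k) (gph_on S2 Om) (u2 k)
                    (p k, - (lam k *: ys (phi k)))].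
Proof.
move=> isc [V1 [V1b _ S1V1]] [V2 [V2b _ S2V2]].
move=> [eps0 eps_cvg zS zcvg znrm] xsx ysy.
have [k|v [vS vcvg]] := isc z _ zcvg.
  have [Ozk [y1 S1y1 [y2 S2y2 y12]]] := zS k.
  by split => //; exists (y1, y2); split.
have [Mx Mx0 xsM] := weak_cvg_bounded xsx.
have [My My0 ysM] := weak_cvg_bounded ysy.
have z1cvg : (z k).1 @[k --> \oo] --> xb.
  by apply: (@cvg_comp _ _ _ z fst _ _ _ zcvg); exact: cvg_fst.
have zv1 : ((z k).1, (v k).1) @[k --> \oo] --> (xb, y1b).
  apply: cvg_pair => //.
  by apply: (@cvg_comp _ _ _ v fst _ _ _ vcvg); exact: cvg_fst.
have zv2 : ((z k).1, (v k).2) @[k --> \oo] --> (xb, y2b).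
  apply: cvg_pair => //.
  by apply: (@cvg_comp _ _ _ v snd _ _ _ vcvg); exact: cvg_snd.
(* [V1] and [V2] must be neighbourhoods of the moving points as well, which holds from [N] on; [phi]
   shifts past [N]. *)
have [N NP] : exists N, forall k, (N <= k)%N ->
    nbhs ((z k).1, (v k).1) V1 /\ nbhs ((z k).1, (v k).2) V2.
  have [N1 _ N1P] := zv1 _ (nbhs_interior V1b).
  have [N2 _ N2P] := zv2 _ (nbhs_interior V2b).
  exists (maxn N1 N2) => k; rewrite geq_max => /andP[N1k N2k].
  by split; [exact: N1P|exact: N2P].
pose phi k := (k + N)%N.
pose c k := 2 * (eps (phi k) * prod_norm (xs (phi k), - ys (phi k)) + k.+1%:R^-1)
            + k.+1%:R^-1.
have step k : exists t : (X * Y) * (X * Y) * R * X * X,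
    let: (u1, u2, lam, a, p) := t in
    [/\ gph_on S1 Om u1, gph_on S2 Om u2,
        `|u1 - ((z (phi k)).1, (v (phi k)).1)| <= k.+1%:R^-1 &
        `|u2 - ((z (phi k)).1, (v (phi k)).2)| <= k.+1%:R^-1] /\
    [/\ 0 <= lam, `|p| ^+ 2 + lam ^+ 2 = 1 &
        `|a - (lam *: xs (phi k) - p)| <= k.+1%:R^-1] /\
    [/\ tangent_cone Om u1.1 a, tangent_cone Om u2.1 p,
        approx_normal (c k) (gph_on S1 Om) u1 (a, - (lam *: ys (phi k))) &
        approx_normal (c k) (gph_on S2 Om) u2 (p, - (lam *: ys (phi k)))].
  have [S1v S2v v12] := vS (phi k).
  have [V1v V2v] := NP (phi k) (leq_addl _ _).
  have [Ozk _] := zS (phi k).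
  have [nrm [tan _]] := znrm (phi k).
  have k0 : 0 < k.+1%:R^-1 :> R by rewrite invr_gt0.
  rewrite [z (phi k)]surjective_pairing -v12 in nrm.
  have [u1 [u2 [lam [a [p H]]]]] := fuzzy_sum_map Ozk S1v S2v V1v V2v S1V1 S2V2
    (eps0 _) k0 nrm tan.
  by exists (u1, u2, lam, a, p).
have [t tP] := choice step.
pose u1 k := (t k).1.1.1.1; pose u2 k := (t k).1.1.1.2.
pose lam k := (t k).1.1.2; pose a k := (t k).1.2; pose p k := (t k).2.
have {}tP k : [/\ gph_on S1 Om (u1 k), gph_on S2 Om (u2 k),
        `|u1 k - ((z (phi k)).1, (v (phi k)).1)| <= k.+1%:R^-1 &
        `|u2 k - ((z (phi k)).1, (v (phi k)).2)| <= k.+1%:R^-1] /\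
    [/\ 0 <= lam k, `|p k| ^+ 2 + lam k ^+ 2 = 1 &
        `|a k - (lam k *: xs (phi k) - p k)| <= k.+1%:R^-1] /\
    [/\ tangent_cone Om (u1 k).1 (a k), tangent_cone Om (u2 k).1 (p k),
        approx_normal (c k) (gph_on S1 Om) (u1 k) (a k, - (lam k *: ys (phi k))) &
        approx_normal (c k) (gph_on S2 Om) (u2 k) (p k, - (lam k *: ys (phi k)))].
  by have := tP k; rewrite /u1 /u2 /lam /a /p; case: (t k) => [[[[]]]].
have phik k : (k <= phi k)%N by rewrite leq_addr.
have c0 k : 0 <= c k.
  by rewrite /c !(addr_ge0, mulr_ge0)// ?prod_norm_ge0.
have inv0 : k.+1%:R^-1 @[k --> \oo] --> (0 : R) := cvg_harmonic.
have c_cvg : c @ \oo --> (0 : R).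
  apply: (@cvg0_norm_le R R^o (fun k =>
    2 * (eps (phi k) * (Mx + My) + k.+1%:R^-1) + k.+1%:R^-1)).
    move=> k; rewrite ger0_norm// /c lerD2r ler_pM2l// lerD2r ler_wpM2l//.
    by apply: le_trans (prod_norm_leD _) _; rewrite /= normrN lerD.
  rewrite -[X in _ --> X](_ : 2 * (0 * (Mx + My) + 0) + 0 = 0); last first.
    by rewrite mul0r !addr0 mulr0.
  apply: cvgD => //; apply: cvgM; first exact: cvg_cst.
  apply: cvgD => //; apply: cvgM; last exact: cvg_cst.
  exact: (cvg_subseq phik eps_cvg).
exists phi, u1, u2, lam, c, a, p; split; last split.
- split => //; try by move=> k; have [[? ? ? ?] [[? ? ?] [? ? ? ?]]] := tP k.
  + refine (@cvg_perturb R (X * Y)%type _ u1 (xb, y1b) _ (cvg_subseq phik zv1)).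
    apply: (@cvg0_norm_le R (X * Y)%type _ _ _ inv0) => k.
    by have [[]] := tP k.
  + refine (@cvg_perturb R (X * Y)%type _ u2 (xb, y2b) _ (cvg_subseq phik zv2)).
    apply: (@cvg0_norm_le R (X * Y)%type _ _ _ inv0) => k.
    by have [[]] := tP k.
- split => //; try by move=> k; have [[? ? ? ?] [[? ? ?] [? ? ? ?]]] := tP k.
  by apply: cvg0_norm_le inv0 => k; have [_ [[]]] := tP k.
- by split => k; have [[? ? ? ?] [[? ? ?] [? ? ? ?]]] := tP k.
Qed.

End sum.

(** * Multipliers bounded away from zero *)

Section multipliers.
Context {R : realType} {X Y : hilbertType R} {Om : set X}.

(** Used with [s] equal to 1 when the multipliers tend to 0, and with [s] their inverses once these
    are bounded. The bound [B] keeps the rescaled errors vanishing. *)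
Lemma approx_normal_subseq (S : X -> set Y) xb yb (u : nat -> X * Y)
    (e : nat -> R) (a : nat -> X) (b : nat -> Y) (theta : nat -> nat)
    (s : nat -> R) (B : R) :
  (forall k, (k <= theta k)%N) ->
  (forall k, gph_on S Om (u k)) -> u @ \oo --> (xb, yb) ->
  (forall k, 0 <= e k) -> e @ \oo --> (0 : R) ->
  (forall k, tangent_cone Om (u k).1 (a k)) ->
  (forall k, approx_normal (e k) (gph_on S Om) (u k) (a k, - b k)) ->
  (forall k, 0 < s k) -> (forall k, s k <= B) ->
  exists eps xs' ys', [/\ normal_seq Om S xb yb eps (u \o theta) xs' ys',
    (fun k => xs' k - s k *: a (theta k)) @ \oo --> (0 : X) &
    (fun k => ys' k - s k *: b (theta k)) @ \oo --> (0 : Y)].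
Proof.
move=> thetak uS ucvg e0 ecvg tan apx s0 sB.
apply: (@approx_normal_seq _ _ _ _ _ _ _ _ (fun k => s k * e (theta k))).
- by move=> k; rewrite mulr_ge0// ltW.
- apply: (@cvg0_norm_le R R^o (fun k => B * e (theta k))).
    by move=> k; rewrite ger0_norm ?ler_wpM2r// mulr_ge0// ltW.
  rewrite -[X in _ --> X](mulr0 B); apply: cvgM; first exact: cvg_cst.
  exact: (cvg_subseq thetak ecvg).
- by move=> k; exact: uS.
- exact: cvg_subseq thetak ucvg.
- move=> k; rewrite -scalerN.
  exact: (@approx_normalZ _ _ _ _ _ _ (a (theta k), - b (theta k)) _ (s0 k) (apx _)).
- by move=> k; apply: tangent_coneZ (s0 k) (tan _).
Qed.

Lemma bounded_cvg0Z (V : normedModType R) (lam : nat -> R) (u : nat -> V) (M : R) :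
  lam @ \oo --> (0 : R) -> (forall k, `|u k| <= M) ->
  (fun k => lam k *: u k) @ \oo --> (0 : V).
Proof.
move=> lam0 uM; apply: (@cvg0_norm_le _ _ (fun k => `|lam k| * M)).
  by move=> k; rewrite normrZ ler_wpM2l.
rewrite -[X in _ --> X](mul0r M) -[X in X * M](@normr0 _ R).
by apply: cvgM; [exact: cvg_norm|exact: cvg_cst].
Qed.

Context (S1 S2 : X -> set Y) (xb : X) (y1b y2b : Y).

(** Otherwise some subsequence has [lam] tending to 0, which kills the contributions of [xs] and
    [ys]: the normals reduce to [- p] for [S1] and [p] for [S2], with second components tending
    strongly to 0, as the mixed coderivatives and PSNC require. *)
Lemma multipliers_bounded_below
    (psnc : PSNC Om S1 xb y1b \/ PSNC Om S2 xb y2b)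
    (qual : mixed_coderivative Om S1 xb y1b 0 `&`
            [set - x | x in mixed_coderivative Om S2 xb y2b 0] = [set 0])
    (u1 u2 : nat -> X * Y) (lam e : nat -> R) (a p xs : nat -> X) (ys : nat -> Y)
    (Mx My : R) :
  (forall k, gph_on S1 Om (u1 k)) -> (forall k, gph_on S2 Om (u2 k)) ->
  u1 @ \oo --> (xb, y1b) -> u2 @ \oo --> (xb, y2b) ->
  (forall k, 0 <= e k) -> e @ \oo --> (0 : R) ->
  (forall k, 0 <= lam k) -> (forall k, `|p k| ^+ 2 + lam k ^+ 2 = 1) ->
  (fun k => a k - (lam k *: xs k - p k)) @ \oo --> (0 : X) ->
  (forall k, `|xs k| <= Mx) -> (forall k, `|ys k| <= My) ->
  (forall k, tangent_cone Om (u1 k).1 (a k)) ->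
  (forall k, tangent_cone Om (u2 k).1 (p k)) ->
  (forall k, approx_normal (e k) (gph_on S1 Om) (u1 k) (a k, - (lam k *: ys k))) ->
  (forall k, approx_normal (e k) (gph_on S2 Om) (u2 k) (p k, - (lam k *: ys k))) ->
  exists2 l : R, 0 < l & exists N, forall k, (N <= k)%N -> l <= lam k.
Proof.
move=> u1S u2S u1cvg u2cvg e0 ecvg lam0 plam acvg xsM ysM Ta Tp apx1 apx2.
apply: contrapT => H.
have small j : exists k, (j <= k)%N /\ lam k < j.+1%:R^-1.
  apply: contrapT => Hj; apply: H; exists j.+1%:R^-1; first by rewrite invr_gt0.
  by exists j => k jk; rewrite leNgt; apply/negP => lamk; apply: Hj; exists k.
have [psi psiP] := choice small.
have lampsi : (lam \o psi) @ \oo --> (0 : R).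
  apply: (@cvg0_norm_le R R^o (fun k => k.+1%:R^-1) (lam \o psi)); last first.
    exact: cvg_harmonic.
  by move=> k; rewrite ger0_norm//=; apply/ltW; have [] := psiP k.
have p1 k : `|p k| <= 1.
  by rewrite -(@ler_pXn2r _ 2) ?nnegrE// expr1n -(plam k) lerDl sqr_ge0.
have [|chi [w [chik pw]]] := @weak_sequential_compactness _ _ (p \o psi) 1.
  by move=> k; exact: p1.
pose theta k := psi (chi k).
have thetak k : (k <= theta k)%N.
  by apply: leq_trans (chik k) _; have [] := psiP (chi k).
have lam_cvg : (fun k => lam (theta k)) @ \oo --> (0 : R) := cvg_subseq chik lampsi.
have lxs : (fun k => lam (theta k) *: xs (theta k)) @ \oo --> (0 : X).
  exact: bounded_cvg0Z lam_cvg (fun k => xsM _).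
have lys : (fun k => lam (theta k) *: ys (theta k)) @ \oo --> (0 : Y).
  exact: bounded_cvg0Z lam_cvg (fun k => ysM _).
have [eps1 [xs1 [ys1 [nrm1 xs1a ys1b]]]] := approx_normal_subseq thetak u1S u1cvg
  e0 ecvg Ta apx1 (fun=> ltr01) (fun=> lexx 1).
have [eps2 [xs2 [ys2 [nrm2 xs2a ys2b]]]] := approx_normal_subseq thetak u2S u2cvg
  e0 ecvg Tp apx2 (fun=> ltr01) (fun=> lexx 1).
have ap : (fun k => a (theta k) + p (theta k)) @ \oo --> (0 : X).
  apply: (@cvg_perturb _ _ (fun k => lam (theta k) *: xs (theta k))) lxs.
  under eq_fun do rewrite -addrA -opprB.
  exact: (cvg_subseq thetak acvg).
have xs1p : (fun k => xs1 k + p (theta k)) @ \oo --> (0 : X).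
  apply: (@cvg_perturb _ _ (fun k => a (theta k) + p (theta k))) ap.
  under eq_fun do rewrite opprD addrACA subrr addr0.
  by under eq_fun do rewrite -[a _]scale1r.
have xs2p : (fun k => xs2 k - p (theta k)) @ \oo --> (0 : X).
  by move: xs2a; under eq_fun do rewrite scale1r.
have ys1_cvg : ys1 @ \oo --> (0 : Y).
  apply: cvg_perturb lys; move: ys1b.
  by under eq_fun do rewrite scale1r.
have ys2_cvg : ys2 @ \oo --> (0 : Y).
  apply: cvg_perturb lys; move: ys2b.
  by under eq_fun do rewrite scale1r.
have xs1w : weak_cvg xs1 (- w).
  apply: weak_cvg_perturb (weak_cvgN pw).
  by move: xs1p; under [in X in _ -> X]eq_fun do rewrite opprK.
have xs2w : weak_cvg xs2 w by exact: weak_cvg_perturb pw.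
have w0 : w = 0.
  have : (mixed_coderivative Om S1 xb y1b 0 `&`
            [set - x | x in mixed_coderivative Om S2 xb y2b 0]) (- w).
    split; first by exists eps1, (u1 \o theta), xs1, ys1.
    by exists w => //; exists eps2, (u2 \o theta), xs2, ys2.
  by rewrite qual => /eqP; rewrite oppr_eq0 => /eqP.
(* PSNC of either mapping suffices, since [xs1 + p] and [xs2 - p] both tend to 0 in norm. *)
have p0 : (fun k => p (theta k)) @ \oo --> (0 : X).
  case: psnc => psnc.
  - rewrite w0 oppr0 in xs1w.
    have /cvg0_norm_le xs10 := psnc _ _ _ _ nrm1 xs1w ys1_cvg.
    have {}xs10 := xs10 _ xs1 (fun=> lexx _).
    rewrite (_ : (fun k => _) = fun k => (xs1 k + p (theta k)) - xs1 k).
      by rewrite -[0]subr0; apply: cvgB.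
    by apply/funext => k; rewrite addrAC subrr add0r.
  - rewrite w0 in xs2w.
    have /cvg0_norm_le xs20 := psnc _ _ _ _ nrm2 xs2w ys2_cvg.
    have {}xs20 := xs20 _ xs2 (fun=> lexx _).
    rewrite (_ : (fun k => _) = fun k => xs2 k - (xs2 k - p (theta k))).
      by rewrite -[0]subr0; apply: cvgB.
    by apply/funext => k; rewrite opprB addrC subrK.
have c10 : (fun=> 1 : R) @ \oo --> (0 : R).
  rewrite (_ : (fun=> _) = fun k => `|p (theta k)| * `|p (theta k)| +
    lam (theta k) * lam (theta k)).
    rewrite -[X in _ --> X](_ : `|0 : X| * `|0 : X| + 0 * 0 = 0); last first.
      by rewrite normr0 !mul0r addr0.
    by apply: cvgD; apply: cvgM => //; exact: cvg_norm.
  by apply/funext => k; rewrite -!expr2 plam.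
have /eqP : (1 : R) = 0 by apply: cvg_unique (cvg_cst (1 : R)) c10.
by rewrite oner_eq0.
Qed.

End multipliers.

(** The common core of both inclusions: [ys1] and [ys2] differ from a subsequence of [ys] by
    norm-null sequences, so they inherit its convergence, strong or weak. *)
Lemma sum_normal_seq (R : realType) (X Y : hilbertType R)
    (S1 S2 : X -> set Y) (Om : set X) (xb : X) (yb y1b y2b : Y)
    (eps : nat -> R) (z : nat -> X * Y) (xs : nat -> X) (ys : nat -> Y) x y :
  closed Om -> convex_set (Om : set (convex_lmodType X)) ->
  inner_semicontinuous (sum_decomp S1 S2) (Om `*` [set: Y]) (xb, yb) (y1b, y2b) ->
  locally_closed_at (gph_on S1 setT) (xb, y1b) ->
  locally_closed_at (gph_on S2 setT) (xb, y2b) ->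
  PSNC Om S1 xb y1b \/ PSNC Om S2 xb y2b ->
  mixed_coderivative Om S1 xb y1b 0 `&`
    [set - x | x in mixed_coderivative Om S2 xb y2b 0] = [set 0] ->
  normal_seq Om (sum_map S1 S2) xb yb eps z xs ys ->
  weak_cvg xs x -> weak_cvg ys y ->
  exists theta w eps1 z1 xs1 ys1 eps2 z2 xs2 ys2,
    [/\ forall k : nat, (k <= theta k)%N,
        weak_cvg xs1 (x - w) & weak_cvg xs2 w] /\
    [/\ normal_seq Om S1 xb y1b eps1 z1 xs1 ys1,
        normal_seq Om S2 xb y2b eps2 z2 xs2 ys2,
        (fun k => ys1 k - ys (theta k)) @ \oo --> (0 : Y) &
        (fun k => ys2 k - ys (theta k)) @ \oo --> (0 : Y)].
Proof.
move=> Om_closed Om_convex isc S1cl S2cl psnc qual nrm xsx ysy.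
have [phi [u1 [u2 [lam [e [a [p]]]]]]] :=
  sum_map_multipliers Om_closed Om_convex isc S1cl S2cl nrm xsx ysy.
move=> [[phik u1S u2S u1cvg u2cvg] [[e0 ecvg lam0 plam acvg] [Ta Tp apx1 apx2]]].
have [Mx Mx0 xsM] := weak_cvg_bounded xsx.
have [My My0 ysM] := weak_cvg_bounded ysy.
have [l l0 [N lamN]] := multipliers_bounded_below psnc qual u1S u2S u1cvg u2cvg
  e0 ecvg lam0 plam acvg (fun k => xsM _) (fun k => ysM _) Ta Tp apx1 apx2.
(* Past [N] the multipliers are at least [l], so these quotients are bounded by [l^-1] and have a
   weak limit [w] along a subsequence. *)
pose q k := (lam (k + N)%N)^-1 *: p (k + N)%N.
have lamk k : l <= lam (k + N)%N by apply: lamN; rewrite leq_addl.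
have lamk0 k : 0 < lam (k + N)%N by exact: lt_le_trans (lamk k).
have lamVl k : (lam (k + N)%N)^-1 <= l^-1 by rewrite lef_pV2 ?posrE.
have qM k : `|q k| <= l^-1.
  rewrite normrZ gtr0_norm ?invr_gt0// -[leRHS]mulr1 ler_pM// ?invr_ge0 ?(ltW (lamk0 k))//.
  by rewrite -(@ler_pXn2r _ 2) ?nnegrE// expr1n -(plam (k + N)%N) lerDl sqr_ge0.
have [chi [w [chik qw]]] := weak_sequential_compactness qM.
pose theta k := (chi k + N)%N.
have thetak k : (k <= theta k)%N by apply: leq_trans (chik k) _; rewrite leq_addr.
have s0 k : 0 < (lam (theta k))^-1 by rewrite invr_gt0; exact: lamk0.
have sB k : (lam (theta k))^-1 <= l^-1 by exact: lamVl.
have [eps1 [xs1 [ys1 [nrm1 xs1a ys1b]]]] := approx_normal_subseq thetak u1S u1cvg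
  e0 ecvg Ta apx1 s0 sB.
have [eps2 [xs2 [ys2 [nrm2 xs2a ys2b]]]] := approx_normal_subseq thetak u2S u2cvg
  e0 ecvg Tp apx2 s0 sB.
have pthk k : (k <= (phi \o theta) k)%N by apply: leq_trans (thetak k) (phik _).
have lamV k (V : lmodType R) (v : V) : (lam (theta k))^-1 *: (lam (theta k) *: v) = v.
  by rewrite scalerA mulVf ?scale1r// gt_eqF//; exact: lamk0.
exists (phi \o theta), w, eps1, (u1 \o theta), xs1, ys1, eps2, (u2 \o theta), xs2, ys2.
split; first split => //; last split => //.
- have : weak_cvg (fun k => (xs \o (phi \o theta)) k - (q \o chi) k) (x - w).
    exact: weak_cvgB (weak_cvg_subseq pthk xsx) qw.
  apply: weak_cvg_perturb.
  (* Divided by [lam], the relation says that [a / lam] is [xs - p / lam] up to a norm-null error,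
     hence the weak limit [x - w]. *)
  have sa : (fun k => (lam (theta k))^-1 *: (a (theta k) -
      (lam (theta k) *: xs (phi (theta k)) - p (theta k)))) @ \oo --> (0 : X).
    apply: (@cvg0_norm_le _ _ (fun k => l^-1 * `|a (theta k) -
      (lam (theta k) *: xs (phi (theta k)) - p (theta k))|)).
      by move=> k; rewrite normrZ gtr0_norm// ler_wpM2r.
    rewrite -[X in _ --> X](mulr0 l^-1) -[X in _ * X](@normr0 _ X).
    apply: cvgM; first exact: cvg_cst.
    by apply: cvg_norm; exact: (cvg_subseq thetak acvg).
  rewrite (_ : (fun k => xs1 k - _) = fun k =>
    (xs1 k - (lam (theta k))^-1 *: a (theta k)) + (lam (theta k))^-1 *:
      (a (theta k) - (lam (theta k) *: xs (phi (theta k)) - p (theta k)))).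
    by rewrite -[X in _ --> X]addr0; exact: cvgD.
  by apply/funext => k /=; rewrite scalerBr subrKA scalerBr lamV.
- apply: weak_cvg_perturb qw; exact: xs2a.
- by move: ys1b; under eq_fun do rewrite lamV.
- by move: ys2b; under eq_fun do rewrite lamV.
Qed.

Unset Implicit Arguments.

Theorem theorem6p5 (R : realType) (X Y : hilbertType R)
  (S1 S2 : X -> set Y) (Om : set X)
  (Om_closed : closed Om)
  (Om_convex : convex_set (Om : set (convex_lmodType X)))
  (xb : X) (yb : Y)
  (xyb : gph_on (sum_map S1 S2) Om (xb, yb))
  (y1b y2b : Y)
  (y12b : sum_decomp S1 S2 (xb, yb) (y1b, y2b))
  (G_isc : inner_semicontinuous (sum_decomp S1 S2) (Om `*` [set: Y])
             (xb, yb) (y1b, y2b))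
  (S1_closed : locally_closed_at (gph_on S1 setT) (xb, y1b))
  (S2_closed : locally_closed_at (gph_on S2 setT) (xb, y2b))
  (psnc : PSNC Om S1 xb y1b \/ PSNC Om S2 xb y2b)
  (qual : mixed_coderivative Om S1 xb y1b 0 `&`
            [set - x | x in mixed_coderivative Om S2 xb y2b 0] = [set 0]) :
  forall ys : Y,
    mixed_coderivative Om (sum_map S1 S2) xb yb ys `<=`
      sum_set (mixed_coderivative Om S1 xb y1b ys)
              (mixed_coderivative Om S2 xb y2b ys) /\
    normal_coderivative Om (sum_map S1 S2) xb yb ys `<=`
      sum_set (normal_coderivative Om S1 xb y1b ys)
              (normal_coderivative Om S2 xb y2b ys).

Proof.
move=> ys; split=> x [eps [z [xk [yk [nrm xkx yky]]]]].
- have [theta [w [eps1 [z1 [xs1 [ys1 [eps2 [z2 [xs2 [ys2]]]]]]]]]] :=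
    sum_normal_seq Om_closed Om_convex G_isc S1_closed S2_closed psnc qual nrm xkx
      (cvg_weak_cvg yky).
  move=> [[thetak xs1w xs2w] [nrm1 nrm2 ys1y ys2y]].
  have yth := cvg_subseq thetak yky.
  exists (x - w); last exists w; last by rewrite subrK.
    by exists eps1, z1, xs1, ys1; split => //; exact: cvg_perturb yth.
  by exists eps2, z2, xs2, ys2; split => //; exact: cvg_perturb yth.
- have [theta [w [eps1 [z1 [xs1 [ys1 [eps2 [z2 [xs2 [ys2]]]]]]]]]] :=
    sum_normal_seq Om_closed Om_convex G_isc S1_closed S2_closed psnc qual nrm xkx yky.
  move=> [[thetak xs1w xs2w] [nrm1 nrm2 ys1y ys2y]].
  have yth := weak_cvg_subseq thetak yky.
  exists (x - w); last exists w; last by rewrite subrK.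
    by exists eps1, z1, xs1, ys1; split => //; exact: weak_cvg_perturb yth.
  by exists eps2, z2, xs2, ys2; split => //; exact: weak_cvg_perturb yth.
Qed.
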